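(* For every theory $\Gamma$ and every sentence $\varphi$ of $\mathcal{L}_2^+$: if $\Gamma\models\varphi$, then $\Gamma\vdash_{g(\Gamma\cup\{\varphi\})}\varphi$. Hence the consequence relation for $\mathcal{L}_2^+$ is in PTIME, i.e. the problem of deciding, given a finite theory $\Gamma$ and a sentence $\varphi$ of $\mathcal{L}_2^+$, whether $\Gamma\models\varphi$ is solvable in polynomial time.
   Context: Syntax of $\mathcal{L}_2^+$. Given a set $P$ of nouns and a set $R$ of verbs. Terms: every noun $p\in P$ is a term; if $r\in R$ and $x$ is a term then $(r\ \mathsf{all}\ x)$ is a term. Sentences, for terms $a,b,x,y$: $(\mathsf{all}\ x\ y)$, $(\mathsf{some}\ x\ y)$, and a four-place sentence written $(\mathsf{all}\ a\ b)\vee(\mathsf{some}\ x\ y)$. A theory is a set of sentences. Semantics. A model $\mathcal{M}$ is a set $M$ (possibly empty) with $[\![p]\!]\subseteq M$ for $p\in P$ and $[\![r]\!]\subseteq M\times M$ for $r\in R$; $[\![r\ \mathsf{all}\ x]\!]=\{m\in M: m\,[\![r]\!]\,n\text{ for all }n\in[\![x]\!]\}$. $\mathcal{M}\models(\mathsf{all}\ x\ y)$ iff $[\![x]\!]\subseteq[\![y]\!]$; $\mathcal{M}\models(\mathsf{some}\ x\ y)$ iff $[\![x]\!]\cap[\![y]\!]\neq\emptyset$; $\mathcal{M}\models(\mathsf{all}\ a\ b)\vee(\mathsf{some}\ x\ y)$ iff $[\![a]\!]\subseteq[\![b]\!]$ or $[\![x]\!]\cap[\![y]\!]\neq\emptyset$.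 $\Gamma\models\varphi$ means every model of $\Gamma$ satisfies $\varphi$. Proof rules (for all terms $a,b,c,t,u,x,y,z$ and verbs $r$): (axiom) infer $(\mathsf{all}\ x\ x)$; (barbara) from $(\mathsf{all}\ x\ y)$, $(\mathsf{all}\ y\ z)$ infer $(\mathsf{all}\ x\ z)$; (anti) from $(\mathsf{all}\ x\ y)$ infer $(\mathsf{all}\ (r\ \mathsf{all}\ y)\ (r\ \mathsf{all}\ x))$; from $(\mathsf{some}\ x\ y)$ infer $(\mathsf{some}\ x\ x)$; from $(\mathsf{some}\ x\ y)$ infer $(\mathsf{some}\ y\ x)$; (darii) from $(\mathsf{some}\ x\ y)$, $(\mathsf{all}\ y\ z)$ infer $(\mathsf{some}\ x\ z)$; infer $(\mathsf{all}\ a\ b)\vee(\mathsf{some}\ a\ a)$ from no premises; infer $(\mathsf{all}\ b\ (r\ \mathsf{all}\ a))\vee(\mathsf{some}\ a\ a)$ from no premises; from $(\mathsf{all}\ a\ b)\vee(\mathsf{some}\ x\ y)$ infer $(\mathsf{all}\ a\ b)\vee(\mathsf{some}\ x\ x)$; from $(\mathsf{all}\ a\ b)\vee(\mathsf{some}\ x\ y)$ infer $(\mathsf{all}\ a\ b)\vee(\mathsf{some}\ y\ x)$; from $(\mathsf{all}\ a\ b)$ infer $(\mathsf{all}\ a\ b)\vee(\mathsf{some}\ x\ y)$; from $(\mathsf{some}\ x\ y)$ infer $(\mathsf{all}\ a\ b)\vee(\mathsf{some}\ x\ y)$; from $(\mathsf{all}\ a\ b)\vee(\mathsf{some}\ x\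 y)$ and $(\mathsf{all}\ b\ c)\vee(\mathsf{some}\ x\ y)$ infer $(\mathsf{all}\ a\ c)\vee(\mathsf{some}\ x\ y)$; from $(\mathsf{all}\ a\ b)\vee(\mathsf{some}\ x\ y)$ infer $(\mathsf{all}\ (r\ \mathsf{all}\ b)\ (r\ \mathsf{all}\ a))\vee(\mathsf{some}\ x\ y)$; from $(\mathsf{some}\ t\ u)$, $(\mathsf{all}\ t\ x)\vee(\mathsf{some}\ x\ y)$, $(\mathsf{all}\ u\ y)\vee(\mathsf{some}\ x\ y)$ infer $(\mathsf{some}\ x\ y)$; from $(\mathsf{all}\ a\ b)\vee(\mathsf{some}\ t\ u)$, $(\mathsf{all}\ t\ x)\vee(\mathsf{some}\ x\ y)$, $(\mathsf{all}\ u\ y)\vee(\mathsf{some}\ x\ y)$ infer $(\mathsf{all}\ a\ b)\vee(\mathsf{some}\ x\ y)$. For a set $A$ of sentences, $\Gamma\vdash_A\varphi$ means there is a finite proof tree with root $\varphi$, all of whose nodes are sentences in $A$, such that each node is either a leaf in $\Gamma$ or the conclusion, with its children the premises, of an instance of one of these rules. The function $g$. For a set $\Delta$ of sentences, $T(\Delta)$ is the set of all subterms of (terms occurring in) sentences in $\Delta$, and $T^+(\Delta)$ is $T(\Delta)$ together with all terms $(r\ \mathsf{all}\ w)$ with $w\in T(\Delta)$ and $r$ a verb occurring in $\Delta$. $g(\Delta)$ is the set consisting of all $(\mathsf{all}\ x\ y)$ with $x\in T(\Delta)$, $y\in T^+(\Delta)$; all $(\mathsf{some}\ u\ v)$ with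 $u,v\in T(\Delta)$; and all $(\mathsf{all}\ x\ y)\vee(\mathsf{some}\ u\ v)$ with $x,u,v\in T(\Delta)$, $y\in T^+(\Delta)$. *)

(* Defs.v *)
From Stdlib Require List.
From HB Require Import structures.
From mathcomp Require Import all_boot all_algebra.
From mathcomp Require Import classical_sets.

Set Implicit Arguments.
Unset Strict Implicit.
Unset Printing Implicit Defensive.

Local Open Scope classical_set_scope.

(** * Syntax of L2+ *)

Inductive term (P R : Type) : Type :=
| Noun of P
| RAll of R & term P R.                            (* (r all x) *)

Inductive sentence (P R : Type) : Type :=
| SAll of term P R & term P R                      (* (all x y) *)
| SSome of term P R & term P R                     (* (some x y) *)
| SOr of term P R & term P R & term P R & term P R (* (all a b) v (some x y) *).

Arguments Noun {P R}.
Arguments RAll {P R}.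
Arguments SAll {P R}.
Arguments SSome {P R}.
Arguments SOr {P R}.

Notation theory P R := (set (sentence P R)).

(** * Semantics *)

(* The carrier may be empty. *)
Record model (P R : Type) : Type := Model {
  carrier :> Type;
  noun_int : P -> set carrier;
  verb_int : R -> set (carrier * carrier) }.

Arguments noun_int {P R} m p.
Arguments verb_int {P R} m r.

Fixpoint interp P R (M : model P R) (x : term P R) : set M :=
  match x with
  | Noun p => noun_int M p
  | RAll r y => [set m | forall n, @interp P R M y n -> verb_int M r (m, n)]
  end.

Arguments interp {P R} M x.

Definition satisfies P R (M : model P R) (f : sentence P R) : Prop :=
  match f with
  | SAll x y => interp M x `<=` interp M y
  | SSome x y => interp M x `&` interp M y !=set0
  | SOr a b x y => (interp M a `<=` interp M b) \/
                   (interp M x `&` interp M y !=set0)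
  end.

Definition entails P R (G : theory P R) (f : sentence P R) : Prop :=
  forall M : model P R, (forall s, G s -> satisfies M s) -> satisfies M f.

(** * Proof system *)

(* [rule prems concl]: the instances of the proof rules. *)
Inductive rule P R : seq (sentence P R) -> sentence P R -> Prop :=
| rule_axiom x : rule [::] (SAll x x)
| rule_barbara x y z : rule [:: SAll x y; SAll y z] (SAll x z)
| rule_anti r x y : rule [:: SAll x y] (SAll (RAll r y) (RAll r x))
| rule_some_refl x y : rule [:: SSome x y] (SSome x x)
| rule_some_sym x y : rule [:: SSome x y] (SSome y x)
| rule_darii x y z : rule [:: SSome x y; SAll y z] (SSome x z)
| rule_or_empty a b : rule [::] (SOr a b a a)
| rule_or_rall_empty a b r : rule [::] (SOr b (RAll r a) a a)
| rule_or_some_refl a b x y : rule [:: SOr a b x y] (SOr a b x x)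
| rule_or_some_sym a b x y : rule [:: SOr a b x y] (SOr a b y x)
| rule_or_introl a b x y : rule [:: SAll a b] (SOr a b x y)
| rule_or_intror a b x y : rule [:: SSome x y] (SOr a b x y)
| rule_or_barbara a b c x y :
    rule [:: SOr a b x y; SOr b c x y] (SOr a c x y)
| rule_or_anti r a b x y :
    rule [:: SOr a b x y] (SOr (RAll r b) (RAll r a) x y)
| rule_some_cases t u x y :
    rule [:: SSome t u; SOr t x x y; SOr u y x y] (SSome x y)
| rule_or_cases a b t u x y :
    rule [:: SOr a b t u; SOr t x x y; SOr u y x y] (SOr a b x y).

(* [derives A G f]: a finite proof tree over G with root f and all nodes in A. *)
Inductive derives P R (A G : theory P R) : sentence P R -> Prop :=
| derives_leaf f : A f -> G f -> derives A G f
| derives_rule prems f :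
    A f -> rule prems f -> (forall s, List.In s prems -> derives A G s) ->
    derives A G f.

(** * The set g(Δ) of sentences *)

Fixpoint subterm P R (s t : term P R) : Prop :=
  s = t \/ match t with Noun _ => False | RAll _ x => subterm s x end.

Definition sentence_terms P R (f : sentence P R) : seq (term P R) :=
  match f with
  | SAll x y => [:: x; y]
  | SSome x y => [:: x; y]
  | SOr a b x y => [:: a; b; x; y]
  end.

Definition T P R (D : theory P R) : set (term P R) :=
  [set s | exists f, D f /\ exists t, List.In t (sentence_terms f) /\ subterm s t].

Definition verb_occurs P R (D : theory P R) (r : R) : Prop :=
  exists x, T D (RAll r x).

Definition Tplus P R (D : theory P R) : set (term P R) :=
  T D `|` [set t | exists r w, [/\ verb_occurs D r, T D w & t = RAll r w]].

Definition g P R (D : theory P R) : theory P R :=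
  [set f | match f with
           | SAll x y => T D x /\ Tplus D y
           | SSome u v => T D u /\ T D v
           | SOr x y u v => [/\ T D x, Tplus D y, T D u & T D v]
           end].

(** * Polynomial time: deterministic multi-tape Turing machines *)

Inductive direction := GoLeft | Stay | GoRight.

Section Tape.
Variable C : Type.

(* A two-way infinite tape over [option C] (with [None] the blank): the cell
   under the head, and the cells on either side, the nearest one first.  All
   cells beyond the end of these sequences are blank. *)
Record tape := Tape {
  tape_left : seq (option C);
  tape_head : option C;
  tape_right : seq (option C) }.

Definition blank_tape : tape := Tape [::] None [::].

Definition input_tape (w : seq C) : tape :=
  Tape [::] (ohead w) [seq Some c | c <- behead w].

Definition tape_write (c : option C) (t : tape) : tape :=
  Tape (tape_left t) c (tape_right t).

Definition tape_move (d : direction) (t : tape) : tape :=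
  let: Tape l h r := t in
  match d with
  | GoLeft => Tape (behead l) (head None l) (h :: r)
  | Stay => t
  | GoRight => Tape (h :: l) (head None r) (behead r)
  end.

End Tape.

(* The tape symbols are those of the input alphabet [S], finitely many work
   symbols, and the blank.  There are [tm_extra.+1] tapes; tape 0 is initialized
   with the input.  [tm_verdict q] is [Some b] if [q] is a halting state with
   answer [b], and [None] otherwise. *)
Record machine (S : finType) := Machine {
  tm_state : finType;
  tm_work : finType;
  tm_extra : nat;
  tm_init : tm_state;
  tm_verdict : tm_state -> option bool;
  tm_trans : tm_state -> {ffun 'I_tm_extra.+1 -> option (S + tm_work)} ->
             tm_state * ('I_tm_extra.+1 -> option (S + tm_work) * direction) }.

Section Run.
Variables (S : finType) (M : machine S).

Record config := Config {
  cfg_state : tm_state M;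
  cfg_tapes : 'I_(tm_extra M).+1 -> tape (S + tm_work M) }.

Definition init_config (w : seq S) : config :=
  Config (tm_init M)
    (fun i => if i == ord0 then input_tape [seq inl s | s <- w]
              else blank_tape _).

Definition step (c : config) : config :=
  if tm_verdict (cfg_state c) is Some _ then c
  else
    let: (q, act) :=
      tm_trans (cfg_state c) [ffun i => tape_head (cfg_tapes c i)] in
    Config q (fun i => tape_move (act i).2
                         (tape_write (act i).1 (cfg_tapes c i))).

Definition answers_within (w : seq S) (n : nat) (b : bool) : Prop :=
  tm_verdict (cfg_state (iter n step (init_config w))) = Some b.

End Run.

(* The decision problem [Q] on instances [X], given to the machine through the
   encoding [enc], is solvable in polynomial time. *)
Definition in_PTIME (S : finType) (X : Type) (enc : X -> seq S) (Q : X -> Prop) :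
    Prop :=
  exists (M : machine S) (p : {poly nat}),
    forall x : X, exists b : bool,
      answers_within M (enc x) (p.[size (enc x)])%R b /\ (b <-> Q x).

(** * Encoding of instances *)

Inductive symbol := Bit of bool | NounTag | VerbTag | AllTag | SomeTag | OrTag.

Definition symbol_code (s : symbol) : option (option bool + option bool) :=
  match s with
  | Bit b => Some (inl (Some b))
  | NounTag => Some (inr (Some true))
  | VerbTag => Some (inr (Some false))
  | AllTag => Some (inl None)
  | SomeTag => Some (inr None)
  | OrTag => None
  end.

Definition symbol_decode (c : option (option bool + option bool)) : symbol :=
  match c with
  | Some (inl (Some b)) => Bit b
  | Some (inr (Some true)) => NounTag
  | Some (inr (Some false)) => VerbTag
  | Some (inl None) => AllTag
  | Some (inr None) => SomeTag
  | None => OrTag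
  end.

Lemma symbol_codeK : cancel symbol_code symbol_decode.
Proof. by case. Qed.

HB.instance Definition _ := Finite.copy symbol (can_type symbol_codeK).

Section Encoding.
Variables (P R : Type) (nameP : P -> seq bool) (nameR : R -> seq bool).

(* Polish notation.  No terminator is needed after a name, as a verb is always
   followed by the tag of a term, and a noun by a tag or the end of the input. *)
Fixpoint encode_term (t : term P R) : seq symbol :=
  match t with
  | Noun p => NounTag :: [seq Bit b | b <- nameP p]
  | RAll r x => VerbTag :: [seq Bit b | b <- nameR r] ++ encode_term x
  end.

Definition encode_sentence (f : sentence P R) : seq symbol :=
  match f with
  | SAll x y => AllTag :: encode_term x ++ encode_term y
  | SSome x y => SomeTag :: encode_term x ++ encode_term y
  | SOr a b x y => OrTag :: encode_term a ++ encode_term b ++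
                            encode_term x ++ encode_term y
  end.

(* The query sentence comes first, then the sentences of the theory. *)
Definition encode (i : seq (sentence P R) * sentence P R) : seq symbol :=
  encode_sentence i.2 ++ flatten [seq encode_sentence f | f <- i.1].

End Encoding.

Section EncodingInjective.
Variables (P R : Type) (nameP : P -> seq bool) (nameR : R -> seq bool).
Hypotheses (nameP_inj : injective nameP) (nameR_inj : injective nameR).

Let not_bit (s : seq symbol) := if s is Bit _ :: _ then false else true.

Let bits_cancel (u v : seq bool) s t : not_bit s -> not_bit t ->
  map Bit u ++ s = map Bit v ++ t -> u = v /\ s = t.
Proof.
elim: u v => [|a u IH] [|b v] //= hs ht.
- by move=> e; rewrite e in hs.
- by move=> e; rewrite -e in ht.
- by case=> -> /(IH _ hs ht) [-> ->].
Qed.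

Let term_not_bit (x : term P R) s : not_bit (encode_term nameP nameR x ++ s).
Proof. by case: x. Qed.

Let encode_term_cancel x y s t : not_bit s -> not_bit t ->
  encode_term nameP nameR x ++ s = encode_term nameP nameR y ++ t ->
  x = y /\ s = t.
Proof.
elim: x y => [p|r x IH] [q|q y] //= hs ht.
- by case=> /(bits_cancel hs ht) [/nameP_inj -> ->].
- case; rewrite -!catA => /bits_cancel [||/nameR_inj ->]; try exact: term_not_bit.
  by move=> /(IH _ hs ht) [-> ->].
Qed.

Let encode_sentence_cancel x y s t : not_bit s -> not_bit t ->
  encode_sentence nameP nameR x ++ s = encode_sentence nameP nameR y ++ t ->
  x = y /\ s = t.
Proof.
move=> hs ht.
case: x => [a b|a b|a b c d]; case: y => [a' b'|a' b'|a' b' c' d'] //= [].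
all: rewrite -!catA.
all: do ?[move=> /encode_term_cancel [||->]; try exact: term_not_bit; try done].
all: by [].
Qed.

Let sentences_not_bit l :
  not_bit (flatten [seq encode_sentence nameP nameR f | f <- l]).
Proof. by case: l => // -[]. Qed.

Lemma encode_inj : injective (encode nameP nameR).
Proof.
move=> [l x] [l' y]; rewrite /encode /=.
move=> /encode_sentence_cancel [||-> e]; try exact: sentences_not_bit.
congr pair; elim: l l' e => [|a l IH] [|b l'] //=.
- by case: b.
- by case: a.
- by case/encode_sentence_cancel => [||->]; try exact: sentences_not_bit; move/IH=> ->.
Qed.

End EncodingInjective.

(* An instance is a finite theory, given by a list of its sentences, together
   with a sentence. *)
Definition consequence P R (i : seq (sentence P R) * sentence P R) : Prop :=
  entails [set f | List.In f i.1] i.2.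

(* Main.v *)
Require Import Defs.
From HB Require Import structures.
From mathcomp Require Import all_boot all_algebra zify.
From mathcomp Require Import boolp classical_sets.

Set Implicit Arguments.
Unset Strict Implicit.
Unset Printing Implicit Defensive.

(* For a fixed query [f], order terms by [x <= y] when inclusion of [x] in [y] is
   forced by [G] and the failure of the some-part of [f].  Pairs [(t, u)] of
   terms that can have a common element without making the some-part of [f] true
   form a model of [G], in which [(t, u)] belongs to [z] iff [t <= z] or
   [u <= z].  Hence [f] follows from [G] iff its all-part lies in the order or
   some [some t u] in [G] is excluded, and both conditions are provable within
   [g].  This order is a least fixed point of simple rules over positions of the
   input word, namely compositions and intersections of binary relations, so it
   is computed by saturating a square table of sets of relation names; a Turing
   machine does this by sweeping three copies of the table row by row. *)

(** * Completeness *)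

(** The order is proved through sentences [all a b] weakened by one fixed some-part, that of the
    query, and it relates only terms occurring in the instance; hence the proofs built from it stay
    inside [g]. Pairs are needed because one element has to witness [some t u], and membership by
    disjunction gives it no more than [t] and [u] force. A machine sees terms only through their
    encoding, with names of unbounded length over a fixed alphabet, so even equality of names is
    computed bit by bit by rules of the same kind. Binary relations suffice although a disjunction
    has four terms: these are adjacent in the word, so the position of one determines those of the
    next. The relation names do not depend on the instance, so a single tape symbol holds a whole
    table entry; the table only grows, so with [N] positions at most [N * N * #|Rel|] rounds change
    it. *)

Section Order.
Local Open Scope classical_set_scope.
Variables (P R : Type) (G : theory P R) (f : sentence P R).
Implicit Types (a b t u v x y z : term P R) (M : model P R).

Definition some_part x y : Prop :=
  match f with
  | SAll _ _ => False
  | SSome x' y' => x = x' /\ y = y'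
  | SOr _ _ x' y' => x = x' /\ y = y'
  end.

Definition all_part a b : Prop :=
  match f with
  | SAll a' b' => a = a' /\ b = b'
  | SSome _ _ => False
  | SOr a' b' _ _ => a = a' /\ b = b'
  end.

Let D := T (G `|` [set f]).

(* [le a b]: [a] is included in [b] in every model of [G] that falsifies the
   some-part of [f].  In [le_or], an element of [t] and [u] would lie in [v] and
   [v'], hence witness the some-part of [f]. *)
Inductive le : term P R -> term P R -> Prop :=
| le_refl x of D x : le x x
| le_trans x y z of le x y & le y z : le x z
| le_anti r x y of D (RAll r x) & D (RAll r y) & le x y :
    le (RAll r y) (RAll r x)
| le_all x y of G (SAll x y) : le x y
| le_or a b t u v v' x y of G (SOr a b t u) & some_part x y &
    v = t \/ v = u & v' = t \/ v' = u & le v x & le v' y : le a b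
| le_empty a b x y of D a & D b & some_part x y & le a x & le a y : le a b
| le_rall_empty r a b x y of D b & D (RAll r a) & some_part x y &
    le a x & le a y : le b (RAll r a).

(** Choosing [v] and [v'] freely among [t] and [u] accounts for the symmetry of [some] and for
    [some t u] implying [some t t] and [some u u]. *)
Definition decided : Prop :=
  (exists t u v v' x y, [/\ G (SSome t u), some_part x y,
      (v = t \/ v = u) /\ (v' = t \/ v' = u), le v x & le v' y]) \/
  (exists a b, all_part a b /\ le a b).

Lemma T_term s t : (G `|` [set f]) s -> List.In t (sentence_terms s) -> D t.
Proof.
by move=> Gs ts; exists s; split=> //; exists t; split=> //; case: (t); left.
Qed.

Lemma subterm_trans x y z : subterm x y -> subterm y z -> subterm x z.
Proof.
elim: z => [p|r z IH] /= xy.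
  by case=> // e; move: xy; rewrite e.
case=> [e|/(IH xy)]; last by right.
by move: xy; rewrite e.
Qed.

Lemma T_body r x : D (RAll r x) -> D x.
Proof.
move=> [s [Gs [t [ts xt]]]]; exists s; split=> //; exists t; split=> //.
by apply: subterm_trans xt; right; case: (x); left.
Qed.

Lemma T_theory s t : G s -> List.In t (sentence_terms s) -> D t.
Proof. by move=> Gs; apply: T_term; left. Qed.

Lemma some_part_T x y : some_part x y -> D x /\ D y.
Proof.
have Df t : List.In t (sentence_terms f) -> D t by apply: T_term; right.
rewrite /some_part; case: f Df => [a b|a b|a b c d] //= Df [-> ->].
  by split; apply: Df; tauto.
by split; apply: Df; tauto.
Qed.

Lemma all_part_T a b : all_part a b -> D a /\ D b.
Proof.
have Df t : List.In t (sentence_terms f) -> D t by apply: T_term; right.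
rewrite /all_part; case: f Df => [x y|x y|x y c d] //= Df [-> ->].
  by split; apply: Df; tauto.
by split; apply: Df; tauto.
Qed.

Lemma le_T x y : le x y -> D x /\ D y.
Proof.
elim=> //.
- by move=> ? ? ? _ [] ? _ _ [].
- by move=> a b Gs; split; apply: T_theory Gs _; rewrite /=; tauto.
- by move=> a b t u ? ? ? ? Gs *; split; apply: T_theory Gs _; rewrite /=; tauto.
Qed.

(** * Soundness of the order *)

Lemma le_sound M : (forall s, G s -> satisfies M s) ->
  (forall x y, some_part x y -> ~ satisfies M (SSome x y)) ->
  forall x y, le x y -> interp M x `<=` interp M y.
Proof.
move=> MG Mf x y; elim=> {x y}.
- by move=> x _ m.
- by move=> x y z _ xy _ yz m /xy /yz.
- by move=> r x y _ _ _ xy m /= h n /xy /h.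
- by move=> x y /MG.
- move=> a b t u v v' x y /MG /= [//|[m [mt mu]]] xy ev ev' _ vx _ vy.
  exfalso; apply: (Mf x y xy); exists m; split.
    by apply: vx; case: ev => ->.
  by apply: vy; case: ev' => ->.
- move=> a b x y _ _ xy _ ax _ ay m ma.
  by exfalso; apply: (Mf x y xy); exists m; split; [apply: ax|apply: ay].
- move=> r a b x y _ _ xy _ ax _ ay m _ n na.
  by exfalso; apply: (Mf x y xy); exists n; split; [apply: ax|apply: ay].
Qed.

(** If [f] fails in a model, so does its some-part. The order is then sound there, and either
    disjunct of [decided] makes [f] true after all. *)
Lemma decided_entails : decided -> entails G f.
Proof.
move=> Df M MG.
have [//|nf] := pselect (satisfies M f); exfalso.
have Mf x y : some_part x y -> ~ satisfies M (SSome x y).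
  rewrite /some_part; case: f nf => [//|x' y'|a b x' y'] nf [-> ->] //.
  by move=> h; apply: nf; right.
case: Df => [[t [u [v [v' [x [y [/MG [m [mt mu]] xy [ev ev'] vx vy]]]]]]]|].
  apply: (Mf x y xy); exists m; split.
    by apply: (le_sound MG Mf vx); case: ev => ->.
  by apply: (le_sound MG Mf vy); case: ev' => ->.
move=> [a [b [ab]]] /(le_sound MG Mf).
move: ab; rewrite /all_part; case: f nf => [a' b'|//|a' b' x y] nf [-> ->] // h.
by apply: nf; left.
Qed.

(** * The countermodel of pairs *)

Definition below (p : term P R * term P R) z := le p.1 z \/ le p.2 z.

(* The elements of the countermodel are the pairs of terms that may have a
   common element without making the some-part of [f] true. *)
Definition admissible (p : term P R * term P R) : Prop :=
  [/\ D p.1, D p.2 &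
      forall x y, some_part x y -> below p x -> below p y -> False].

Definition countermodel : model P R :=
  Model (carrier := {p | admissible p})
    (fun n => [set m | below (sval m) (Noun n)])
    (fun r => [set mn | exists2 w, below (sval mn.1) (RAll r w) &
                                   below (sval mn.2) w]).

(** The terms [v] and [v'] obtained from an inadmissible pair are those that [le_or] and [decided]
    ask for. *)
Lemma admissibleN t u : D t -> D u -> ~ admissible (t, u) ->
  exists v v' x y, [/\ some_part x y, v = t \/ v = u, v' = t \/ v' = u,
    le v x & le v' y].
Proof.
move=> Dt Du h.
suff: exists x y, [/\ some_part x y, below (t, u) x & below (t, u) y].
  move=> [x [y [xy bx by_]]].
  have [v ev vx] : exists2 v, v = t \/ v = u & le v x.
    by case: bx; [exists t|exists u]; auto.
  have [v' ev' vy] : exists2 v, v = t \/ v = u & le v y.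
    by case: by_; [exists t|exists u]; auto.
  by exists v, v', x, y.
apply: contrapT => n; apply: h; split=> // x y xy bx by_.
by apply: n; exists x, y.
Qed.

Lemma below_le p y z : below p y -> le y z -> below p z.
Proof. by move=> [] h yz; [left|right]; apply: le_trans yz. Qed.

(** For [RAll r w] the pair [(w, w)] serves as test element: being related to it yields some [v]
    with [w <= v] and [m] below [RAll r v], and [le_anti] finishes. If [(w, w)] is inadmissible,
    then [le_rall_empty] puts every term of [D] below [RAll r w]. *)
Lemma truth z (m : countermodel) : D z ->
  interp countermodel z m <-> below (sval m) z.
Proof.
elim: z m => [//|r w IH] m Drw; have Dw := T_body Drw.
split=> [h|mw n /= /IH nw]; last by exists w => //; apply: nw.
have [ww|/(admissibleN Dw Dw)] := pselect (admissible (w, w)); last first.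
  move=> [v [v' [x [y [xy ev ev' vx vy]]]]].
  have ev0 : v = w by case: ev.
  have ev0' : v' = w by case: ev'.
  have [D1 _ _] := svalP m.
  by left; apply: (le_rall_empty _ _ xy) => //; [rewrite -ev0|rewrite -ev0'].
have /h : interp countermodel w (exist _ (w, w) ww).
  by apply/IH => //; left; apply: le_refl.
move=> [v /= mv wv]; apply: (below_le mv).
have {}wv : le w v by case: wv.
apply: le_anti => //.
by case: mv => /le_T [].
Qed.

Lemma entails_decided : entails G f -> decided.
Proof.
move=> Gf; apply: contrapT => nd.
have adm t u : G (SSome t u) -> admissible (t, u).
  move=> Gtu; apply: contrapT => /admissibleN.
  case; [exact: T_theory Gtu (or_introl erefl)|
         exact: T_theory Gtu (or_intror (or_introl erefl))|].
  move=> v [v' [x [y [xy ev ev' vx vy]]]]; apply: nd; left.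
  by exists t, u, v, v', x, y.
have meet t u (h : admissible (t, u)) :
    interp countermodel t `&` interp countermodel u !=set0.
  have [Dt Du _] := h; exists (exist _ (t, u) h).
  by split; apply/truth => //; [left|right]; apply: le_refl.
have : satisfies countermodel f.
  apply: Gf => -[x y|t u|a b t u] Gs /=; last 1 first.
  - have [Da [Db [Dt Du]]] : D a /\ D b /\ D t /\ D u.
      by do ![split]; apply: T_theory Gs _; rewrite /=; tauto.
    (* Either [(t, u)] is an element and witnesses the some-part of the premise, or its
       inadmissibility makes [le_or] yield the all-part. *)
    have [/meet|/(admissibleN Dt Du)] := pselect (admissible (t, u)); first by right.
    move=> [v [v' [x [y [xy ev ev' vx vy]]]]]; left=> m /truth ma.
    by apply/truth => //; apply: below_le (ma Da) (le_or Gs xy ev ev' vx vy).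
  - have xy := le_all Gs; have [Dx Dy] := le_T xy.
    by move=> m /truth mx; apply/truth => //; apply: below_le (mx Dx) xy.
  - exact/meet/adm.
have nsome x y : some_part x y ->
    interp countermodel x `&` interp countermodel y !=set0 -> False.
  move=> xy [m [mx my]]; have [Dx Dy] := some_part_T xy.
  by have [_ _ h] := svalP m; apply: h xy _ _; apply/truth.
(* The pair [(a, a)] lies in [a], and in [b] only if [a <= b]. If it is inadmissible, [le_empty]
   gives [a <= b] directly. *)
have nall a b : all_part a b ->
    interp countermodel a `<=` interp countermodel b -> False.
  move=> ab h; have [Da Db] := all_part_T ab.
  have nle : ~ le a b by move=> leab; apply: nd; right; exists a, b.
  have [aa|/(admissibleN Da Da)] := pselect (admissible (a, a)).
    have /h/truth : interp countermodel a (exist _ (a, a) aa).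
      by apply/truth => //; left; apply: le_refl.
    by case/(_ Db).
  move=> [v [v' [x [y [xy ev ev' vx vy]]]]]; apply: nle.
  have ev0 : v = a by case: ev.
  have ev0' : v' = a by case: ev'.
  by apply: (le_empty _ _ xy) => //; [rewrite -ev0|rewrite -ev0'].
move: nsome nall; rewrite /some_part /all_part.
case: f => [a b|x y|a b x y] nsome nall /=.
- exact: nall.
- exact: nsome.
- by case; [apply: nall|apply: nsome].
Qed.

(** * Proofs inside [g] *)

Let g_sentences := g (G `|` [set f]).

(** The sentence whose derivation certifies [le a b]. *)
Definition modulo_some_part a b : sentence P R :=
  match f with
  | SAll _ _ => SAll a b
  | SSome x y => SOr a b x y
  | SOr _ _ x y => SOr a b x y
  end.

Lemma theory_g s : (G `|` [set f]) s -> g_sentences s.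
Proof.
by move=> Gs; case: s Gs => [a b|a b|a b c d] Gs; split; try left;
  apply: T_term Gs _; rewrite /=; tauto.
Qed.

Lemma g_modulo a b : D a -> D b -> g_sentences (modulo_some_part a b).
Proof.
move=> Da Db; rewrite /modulo_some_part; move: (@some_part_T).
rewrite /some_part; case: f => [c d|x y|c d x y] xyD; split=> //; try by left.
all: by have [] := xyD x y.
Qed.

Lemma modulo_someE x y a b : some_part x y -> modulo_some_part a b = SOr a b x y.
Proof.
by rewrite /some_part /modulo_some_part; case: f => [//|? ?|? ? ? ?] [-> ->].
Qed.

(** With the premises as a computed conjunction, applying a rule leaves exactly its premises as
    goals. *)
Lemma derives_ruleI prems s : g_sentences s -> rule prems s ->
  foldr (fun s' Q => derives g_sentences G s' /\ Q) True prems ->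
  derives g_sentences G s.
Proof.
move=> gs r h; apply: derives_rule r _ => // t.
by elim: prems h => //= a l IH [ha hl] [<-//|/IH]; apply.
Qed.

Lemma derives_pair t u v v' : v = t \/ v = u -> v' = t \/ v' = u ->
  D t -> D u -> derives g_sentences G (SSome t u) ->
  derives g_sentences G (SSome v v').
Proof.
move=> ev ev' Dt Du h.
have h' : derives g_sentences G (SSome u t).
  by apply: derives_ruleI (rule_some_sym t u) _.
case: ev => ->; case: ev' => -> //.
  by apply: derives_ruleI (rule_some_refl t u) _.
by apply: derives_ruleI (rule_some_refl u t) _.
Qed.

Lemma derives_or_pair a b t u v v' : v = t \/ v = u -> v' = t \/ v' = u ->
  D a -> D b -> D t -> D u -> derives g_sentences G (SOr a b t u) ->
  derives g_sentences G (SOr a b v v').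
Proof.
move=> ev ev' Da Db Dt Du h.
have gor x y : D x -> D y -> g_sentences (SOr a b x y).
  by move=> Dx Dy; split=> //; left.
have h' : derives g_sentences G (SOr a b u t).
  by apply: derives_ruleI (rule_or_some_sym a b t u) _ => //; apply: gor.
case: ev => ->; case: ev' => -> //.
  by apply: derives_ruleI (rule_or_some_refl a b t u) _ => //; apply: gor.
by apply: derives_ruleI (rule_or_some_refl a b u t) _ => //; apply: gor.
Qed.

Lemma le_derives a b : le a b -> derives g_sentences G (modulo_some_part a b).
Proof.
have weaken a' b' : D a' -> D b' -> derives g_sentences G (SAll a' b') ->
    derives g_sentences G (modulo_some_part a' b').
  move=> Da Db h; have := g_modulo Da Db.
  rewrite /modulo_some_part; case: f => [//|x y|_ _ x y] gs.
    by apply: derives_ruleI (rule_or_introl a' b' x y) _.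
  by apply: derives_ruleI (rule_or_introl a' b' x y) _.
(* [rule_or_cases] trades [some t u] for the some-part of [f]; the three constructors of [le] that
   mention [some_part] all go through it. *)
have cases a' b' t u x y : D a' -> D b' -> some_part x y -> le t x -> le u y ->
    derives g_sentences G (SOr a' b' t u) ->
    derives g_sentences G (modulo_some_part t x) ->
    derives g_sentences G (modulo_some_part u y) ->
    derives g_sentences G (modulo_some_part a' b').
  move=> Da Db xy /le_T [Dt Dx] /le_T [Du Dy]; have := g_modulo Da Db.
  rewrite !(modulo_someE _ _ xy) => gs h1 h2 h3.
  by apply: derives_ruleI (rule_or_cases a' b' t u x y) _.
elim=> {a b}.
- move=> x Dx; apply: weaken => //.
  by apply: derives_ruleI (rule_axiom x) _ => //; split=> //; left.
- move=> x y z xy dxy yz dyz.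
  have := g_modulo (le_T xy).1 (le_T yz).2; move: dxy dyz.
  rewrite /modulo_some_part; case: f => [_ _|u v|_ _ u v] d1 d2 gs.
  + by apply: derives_ruleI (rule_barbara x y z) _.
  + by apply: derives_ruleI (rule_or_barbara x y z u v) _.
  + by apply: derives_ruleI (rule_or_barbara x y z u v) _.
- move=> r x y Drx Dry xy; have := g_modulo Dry Drx.
  rewrite /modulo_some_part; case: f => [_ _|u v|_ _ u v] gs d.
  + by apply: derives_ruleI (rule_anti r x y) _.
  + by apply: derives_ruleI (rule_or_anti r x y u v) _.
  + by apply: derives_ruleI (rule_or_anti r x y u v) _.
- move=> x y Gs; have [Dx Dy] := le_T (le_all Gs); apply: weaken => //.
  by apply: derives_leaf => //; apply: theory_g; left.
- move=> a b t u v v' x y Gs xy ev ev' vx dvx vy dvy.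
  have [Da [Db [Dt Du]]] : D a /\ D b /\ D t /\ D u.
    by do ![split]; apply: T_theory Gs _; rewrite /=; tauto.
  apply: (cases _ _ v v' x y) => //.
  apply: (derives_or_pair ev ev') => //.
  by apply: derives_leaf => //; apply: theory_g; left.
- move=> a b x y Da Db xy ax dax ay day; apply: (cases _ _ a a x y) => //.
  by apply: derives_ruleI (rule_or_empty a b) _ => //; split=> //; left.
- move=> r a b x y Db Dra xy ax dax ay day; apply: (cases _ _ a a x y) => //.
  apply: derives_ruleI (rule_or_rall_empty a b r) _ => //.
  by have [Da _] := le_T ax; split=> //; left.
Qed.

Lemma decided_derives : decided -> derives g_sentences G f.
Proof.
have gf : g_sentences f by apply: theory_g; right.
case=> [[t [u [v [v' [x [y [Gtu xy [ev ev'] vx vy]]]]]]]|[a [b [ab]]]].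
  have [Dt [Du [Dx Dy]]] : D t /\ D u /\ D x /\ D y.
    split; first by apply: T_theory Gtu _; left.
    split; first by apply: T_theory Gtu _; right; left.
    exact: some_part_T.
  have dxy : derives g_sentences G (SSome x y).
    apply: derives_ruleI (rule_some_cases v v' x y) _ => //.
    move: (le_derives vx) (le_derives vy); rewrite !(modulo_someE _ _ xy) => ? ?.
    split=> //; apply: (derives_pair ev ev') => //.
    by apply: derives_leaf => //; apply: theory_g; left.
  move: xy gf; rewrite /some_part; case: f => [//|x' y'|a b x' y'] [ex ey] gf.
    by rewrite -ex -ey.
  rewrite ex ey in dxy.
  by apply: derives_ruleI (rule_or_intror a b x' y') _.
move=> /le_derives; move: ab; rewrite /all_part /modulo_some_part.
by case: f => [a' b'|//|a' b' x y] [-> ->].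
Qed.

End Order.

(** * Programs over five tapes *)

Section Views.
Variable C : Type.

(* A tape with addressed cells.  Address 0 has no left neighbour: moving left
   from it shifts the addresses. *)
Record view := View { cells : nat -> option C; pos : nat }.

Definition view_head (v : view) := cells v (pos v).

Definition view_move (d : direction) (v : view) : view :=
  match d with
  | GoLeft => if pos v is p.+1 then View (cells v) p
              else View (fun k => if k is k'.+1 then cells v k' else None) 0
  | Stay => v
  | GoRight => View (cells v) (pos v).+1
  end.

(* The first component is [None] if nothing is written. *)
Definition action := (option (option C) * direction)%type.

Definition view_act (a : action) (v : view) : view :=
  view_move a.2
    (if a.1 is Some c then
       View (fun k => if k == pos v then c else cells v k) (pos v)
     else v).

(** Everything left of address 0 is blank, as are the cells beyond the ends of the two sequences by
    the default of [nth]. *)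
Definition represents (t : tape C) (v : view) : Prop :=
  [/\ tape_head t = view_head v,
      forall k, nth None (tape_right t) k = cells v (pos v + k.+1) &
      forall k, nth None (tape_left t) k =
                if k < pos v then cells v (pos v - k.+1) else None].

(** A machine always writes, so an action that writes nothing becomes rewriting the scanned
    symbol. *)
Lemma represents_act (a : action) t v : represents t v ->
  represents (tape_move a.2 (tape_write (odflt (view_head v) a.1) t))
             (view_act a v).
Proof.
rewrite /view_act; case: a => wr d; rewrite [_.1]/= [_.2]/=.
set v' := (v in view_move _ v); move=> h.
have {h} : represents (tape_write (odflt (view_head v) wr) t) v'.
  case: h => h1 h2 h3; rewrite /v' {v'}; case: wr => [c|] //=.
  split=> [|k|k] /=; first by rewrite /view_head /= eqxx.
    by rewrite h2 -[X in _ == X]addn0 eqn_add2l.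
  rewrite h3; case: ifP => // kp; case: eqP => //; lia.
move: (tape_write _ _) v' => {wr v} [l h r] [f p] {t} [/= -> hr hl].
case: d => /=.
- case: p hr hl => [|p] hr hl; split=> /=.
  + by rewrite -nth0 hl.
  + by case=> [|k] //=; rewrite hr.
  + by move=> k; rewrite nth_behead hl.
  + by rewrite -nth0 hl /view_head /= subn1.
  + by case=> [|k] /=; rewrite ?hr; congr f; lia.
  + by move=> k; rewrite nth_behead hl ltnS.
- by split.
- split=> /=.
  + by rewrite -nth0 hr addn1.
  + by move=> k; rewrite nth_behead hr; congr f; lia.
  + case=> [|k] /=; first by rewrite subn1.
    by rewrite hl ltnS subSS.
Qed.

Lemma represents_blank p : represents (blank_tape C) (View (fun=> None) p).
Proof. by split=> [|[|k]|[|k]] //=; rewrite if_same. Qed.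

(** The input starts at address 1, which leaves a blank at address 0 as the sentinel on which
    [Rewind] stops. *)
Lemma represents_input (w : seq C) :
  represents (input_tape w) (View (fun k => if k is i.+1 then onth w i else None) 1).
Proof.
split=> [|k|[|k]] /=; first by case: w.
- case: w => [|c w] /=; first by case: k.
  by rewrite onthE.
- by [].
- by [].
Qed.

(** The input, a copy of it with the position of the current row marked, and the three copies of the
    table. *)
Inductive tape_id := TIn | TMark | TA | TB | TC.

Record five X := Five { f_in : X; f_mark : X; f_a : X; f_b : X; f_c : X }.

Definition sel X t (x : five X) : X :=
  match t with
  | TIn => f_in x | TMark => f_mark x | TA => f_a x | TB => f_b x | TC => f_c x
  end.

Definition put X t y (x : five X) : five X :=
  let: Five a b c d e := x in
  match t with
  | TIn => Five y b c d e
  | TMark => Five a y c d e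
  | TA => Five a b y d e
  | TB => Five a b c y e
  | TC => Five a b c d y
  end.

Definition tapes := five view.
Definition heads (x : tapes) : five (option C) :=
  let: Five a b c d e := x in
  Five (view_head a) (view_head b) (view_head c) (view_head d) (view_head e).
Definition act (u : five action) (x : tapes) : tapes :=
  let: Five u1 u2 u3 u4 u5 := u in
  let: Five a b c d e := x in
  Five (view_act u1 a) (view_act u2 b) (view_act u3 c) (view_act u4 d) (view_act u5 e).

Definition idle : action := (None, Stay).
Definition idles : five action := Five idle idle idle idle idle.

(* [inr b]: the program stops with answer [b] after performing the actions. *)
Record prog := Prog {
  pst : finType;
  pstart : pst;
  ptrans : pst -> five (option C) -> (pst + bool) * five action }.

(** [runs_stop] accepts every positive [n], so [n] is an upper bound on the number of steps. *)
Inductive runs (F : prog) : pst F -> tapes -> nat -> bool -> tapes -> Prop :=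
| runs_stop s x n b u : ptrans s (heads x) = (inr b, u) ->
    runs s x n.+1 b (act u x)
| runs_step s x s' u n b y : ptrans s (heads x) = (inl s', u) ->
    runs s' (act u x) n b y -> runs s x n.+1 b y.

Definition run F x n b y := runs (pstart F) x n b y.

Lemma runs_widen F (s : pst F) x n m b y :
  n <= m -> runs s x n b y -> runs s x m b y.
Proof.
move=> nm h; elim: h m nm => {s x n b y} [s x n b u e|s x s' u n b y e _ IH] [//|m] nm.
  exact: runs_stop.
by apply: runs_step e _; apply: IH.
Qed.

Lemma runs_stop_eq (F : prog) (s : pst F) x n b u y :
  ptrans s (heads x) = (inr b, u) -> act u x = y -> runs s x n.+1 b y.
Proof. by move=> e <-; apply: runs_stop. Qed.

Lemma runs_step_eq (F : prog) (s : pst F) x s' u x' n b y :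
  ptrans s (heads x) = (inl s', u) -> act u x = x' ->
  runs s' x' n b y -> runs s x n.+1 b y.
Proof. by move=> e <-; apply: runs_step e. Qed.

Definition Act (f : five (option C) -> bool * five action) : prog :=
  @Prog unit tt (fun _ h => let: (b, u) := f h in (inr b, u)).

(** The transition that ends [F] already enters the start state of [G] or [H], so branching costs no
    step. *)
Definition If (F G H : prog) : prog :=
  @Prog (pst F + (pst G + pst H))%type (inl (pstart F))
    (fun s h => match s with
     | inl s => let: (o, u) := ptrans s h in
         (inl (match o with
          | inl s' => inl s'
          | inr true => inr (inl (pstart G))
          | inr false => inr (inr (pstart H)) end), u)
     | inr (inl s) => let: (o, u) := ptrans s h in
         (match o with inl s' => inl (inr (inl s')) | inr b => inr b end, u)
     | inr (inr s) => let: (o, u) := ptrans s h in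
         (match o with inl s' => inl (inr (inr s')) | inr b => inr b end, u)
     end).

Definition Seq F G := If F G G.

Definition Loop (F : prog) : prog :=
  @Prog (pst F) (pstart F)
    (fun s h => let: (o, u) := ptrans s h in
       (match o with
        | inl s' => inl s'
        | inr true => inl (pstart F)
        | inr false => inr false end, u)).

Lemma run_Act f x n : run (Act f) x n.+1 (f (heads x)).1 (act (f (heads x)).2 x).
Proof. by apply: runs_stop => /=; case: (f _). Qed.

Lemma run_If F G H x n m b b' y z : run F x n b y ->
  run (if b then G else H) y m b' z -> run (If F G H) x (n + m) b' z.
Proof.
rewrite {1 3}/run /=; move: (pstart F) => s h.
elim: h => {s x n b y} [s x n b u e|s x s' u n b y e _ IH].
  rewrite /run => h; rewrite addSn.
  apply: (@runs_step (If F G H) _ _ _ u); first by rewrite /= e.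
  apply: (@runs_widen _ _ _ m); first exact: leq_addl.
  case: b e h => _.
    move: (pstart G) => t h; elim: h => {m b' z} {}t {}x m.
      by move=> b' v e; apply: (@runs_stop (If F G H)); rewrite /= e.
    move=> t' v b' z e _ IH; apply: (@runs_step (If F G H)) IH; by rewrite /= e.
  move: (pstart H) => t h; elim: h => {m b' z} {}t {}x m.
    by move=> b' v e; apply: (@runs_stop (If F G H)); rewrite /= e.
  by move=> t' v b' z e _ IH; apply: (@runs_step (If F G H)) IH; rewrite /= e.
move=> /IH h; rewrite addSn; apply: (@runs_step (If F G H)) h.
by rewrite /= e.
Qed.

Lemma run_Seq F G x n m b b' y z : run F x n b y -> run G y m b' z ->
  run (Seq F G) x (n + m) b' z.
Proof. by move=> h h'; apply: run_If h _; rewrite if_same. Qed.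

Lemma run_Loop_stop F x n y : run F x n false y -> run (Loop F) x n false y.
Proof.
rewrite /run /=; move: (pstart F) => s; move e0: false => b0 h.
elim: h e0 => {s x n b0 y} [s x n b u e|s x s' u n b y e _ IH] eb.
  by apply: runs_stop; rewrite /= e -eb.
by apply: (@runs_step (Loop F)) (IH eb); rewrite /= e.
Qed.

Lemma run_Loop_next F x n m y z : run F x n true y ->
  run (Loop F) y m false z -> run (Loop F) x (n + m) false z.
Proof.
move=> h h'; move: h; rewrite /run /=; move: (pstart F) => s.
move e0: true => b0 h.
elim: h e0 h' => {s x n b0 y} [s x n b u e|s x s' u n b y e _ IH] eb h'.
  rewrite addSn; apply: (@runs_step (Loop F)).
    by rewrite /= e -eb.
  by apply: runs_widen h'; apply: leq_addl.
by rewrite addSn; apply: (@runs_step (Loop F)) (IH eb h'); rewrite /= e.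
Qed.

(** [x k] describes the tapes before iteration [k]; iteration [m] is the one that answers false. *)
Lemma run_Loop F (x : nat -> tapes) m n y :
  (forall k, k < m -> run F (x k) n true (x k.+1)) ->
  run F (x m) n false y -> run (Loop F) (x 0) (m.+1 * n) false y.
Proof.
elim: m x => [|m IH] x h hm; first by rewrite mul1n; apply: run_Loop_stop.
rewrite mulSn; apply: (run_Loop_next (h 0 isT)).
by apply: (IH (fun k => x k.+1)) => [k km|//]; apply: h.
Qed.

Lemma act_put t u x : act (put t u idles) x = put t (view_act u (sel t x)) x.
Proof. by case: t; case: x. Qed.

Lemma heads_sel t x : sel t (heads x) = view_head (sel t x).
Proof. by case: t; case: x. Qed.

Lemma put_put X t (u v : X) x : put t u (put t v x) = put t u x.
Proof. by case: t; case: x. Qed.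

Lemma sel_put X t (u : X) x : sel t (put t u x) = u.
Proof. by case: t; case: x. Qed.

Lemma put_sel X t (x : five X) : put t (sel t x) x = x.
Proof. by case: t; case: x. Qed.

(** Test and move share one step; the first cell that fails [p] is left in direction [d']. *)
Definition Sweep t (p : option C -> bool) d d' : prog :=
  Loop (Act (fun h => (p (sel t h),
                       put t (None, if p (sel t h) then d else d') idles))).

Lemma run_Sweep t (p : pred (option C)) d d' x (v : nat -> view) m :
  sel t x = v 0 ->
  (forall k, k < m -> p (view_head (v k)) /\ view_move d (v k) = v k.+1) ->
  ~~ p (view_head (v m)) ->
  run (Sweep t p d d') x m.+1 false (put t (view_move d' (v m)) x).
Proof.
move=> x0 step stop; rewrite -[m.+1]muln1.
have -> : x = put t (v 0) x by rewrite -x0 put_sel.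
rewrite put_put.
apply: (@run_Loop _ (fun k => put t (v k) x)) => [k km|].
  have [pk ek] := step k km.
  have := run_Act (fun h => (p (sel t h),
     put t (None, if p (sel t h) then d else d') idles)) (put t (v k) x) 0.
  by rewrite /= !heads_sel sel_put pk act_put sel_put put_put /view_act /= ek.
have := run_Act (fun h => (p (sel t h),
   put t (None, if p (sel t h) then d else d') idles)) (put t (v m) x) 0.
by rewrite /= !heads_sel sel_put (negbTE stop) act_put sel_put put_put.
Qed.

Definition Rewind t := Sweep t isSome GoLeft GoRight.

Lemma run_Rewind t x f p : sel t x = View f p -> f 0 = None ->
  (forall k, 0 < k <= p -> f k) ->
  run (Rewind t) x p.+1 false (put t (View f 1) x).
Proof.
move=> xt f0 fp.
have := @run_Sweep t isSome GoLeft GoRight x (fun k => View f (p - k)) p.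
rewrite /view_head /= subnn f0 subn0; apply=> // k kp; split; first by apply: fp; lia.
by case e : (p - k) => [|q]; [lia|congr View; lia].
Qed.

Definition Move t d : prog := Act (fun=> (true, put t (None, d) idles)).

Lemma run_Move t d x : run (Move t d) x 1 true (put t (view_move d (sel t x)) x).
Proof.
by have := run_Act (fun=> (true, put t (None, d) idles)) x 0; rewrite /= act_put.
Qed.

(* From the blank after the contents of the tape to their first cell. *)
Definition Back t := Seq (Move t GoLeft) (Rewind t).

Lemma run_Back t x f p : sel t x = View f p.+1 -> f 0 = None ->
  (forall k, 0 < k <= p -> f k) ->
  run (Back t) x p.+2 false (put t (View f 1) x).
Proof.
move=> xt f0 fp; apply: (@run_Seq _ _ _ 1); first exact: run_Move.
rewrite xt /= -(put_put t (View f 1) (View f p)).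
by apply: run_Rewind => //; rewrite sel_put.
Qed.

Definition Answer b : prog := Act (fun=> (b, idles)).

Lemma run_Answer b x : run (Answer b) x 1 b x.
Proof.
have := run_Act (fun=> (b, idles)) x 0; rewrite /=.
by case: x => a c d e g; rewrite /= /view_act.
Qed.

Definition Test (f : five (option C) -> bool) : prog := Act (fun h => (f h, idles)).

Lemma run_Test f x : run (Test f) x 1 (f (heads x)) x.
Proof.
have := run_Act (fun h => (f h, idles)) x 0; rewrite /=.
by case: x => a c d e g; rewrite /= /view_act.
Qed.

End Views.

(** * Programs as Turing machines *)

Section ToMachine.
Variables (S W : finType) (F : prog (S + W)).

Definition tape_id_of (i : 'I_5) : tape_id :=
  match val i with 0 => TIn | 1 => TMark | 2 => TA | 3 => TB | _ => TC end.

Definition tape_index (t : tape_id) : 'I_5 :=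
  inord match t with TIn => 0 | TMark => 1 | TA => 2 | TB => 3 | TC => 4 end.

Lemma tape_indexK : cancel tape_index tape_id_of.
Proof. by case; rewrite /tape_id_of /tape_index /= inordK. Qed.

Definition five_of X (h : tape_id -> X) : five X :=
  Five (h TIn) (h TMark) (h TA) (h TB) (h TC).

Lemma sel_five_of X (h : tape_id -> X) t : sel t (five_of h) = h t.
Proof. by case: t. Qed.

Lemma five_eq X (x y : five X) : (forall t, sel t x = sel t y) -> x = y.
Proof.
case: x y => [a b c d e] [a' b' c' d' e'] h.
by congr Five; [have := h TIn|have := h TMark|have := h TA|have := h TB|have := h TC].
Qed.

Definition machine_of : machine S :=
  @Machine S (pst F + bool)%type W 4 (inl (pstart F))
    (fun q => if q is inr b then Some b else None)
    (fun q h =>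
       match q with
       | inl s =>
         let: (o, u) := ptrans s (five_of (fun t => h (tape_index t))) in
         (match o with inl s' => inl s' | inr b => inr b end,
          fun i => let a := sel (tape_id_of i) u in (odflt (h i) a.1, a.2))
       | inr b => (inr b, fun i => (h i, Stay))
       end).

(** A halted machine keeps its configuration, so a verdict reached early is still there at the time
    bound. *)
Lemma iter_step_halted n (c : config machine_of) b :
  tm_verdict (cfg_state c) = Some b -> tm_verdict (cfg_state (iter n (@step S machine_of) c)) = Some b.
Proof.
by elim: n c => [//|n IH] c h; rewrite iterS {1}/step (IH _ h) (IH _ h).
Qed.

Lemma run_machine s x n b y : @runs _ F s x n b y ->
  forall c : config machine_of, cfg_state c = inl s ->
    (forall i, represents (cfg_tapes c i) (sel (tape_id_of i) x)) ->
  tm_verdict (cfg_state (iter n (@step S machine_of) c)) = Some b.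
Proof.
have heads_of (c : config machine_of) x' :
    (forall i, represents (cfg_tapes c i) (sel (tape_id_of i) x')) ->
    heads x' = five_of (fun t => [ffun i => tape_head (cfg_tapes c i)] (tape_index t)).
  move=> cx; apply: five_eq => t; rewrite sel_five_of ffunE heads_sel.
  by have [-> _ _] := cx (tape_index t); rewrite tape_indexK.
elim=> {s x n b y} [s x n b u e|s x s' u n b y e _ IH] c cs cx; rewrite iterSr.
  apply: iter_step_halted; rewrite /step cs /=.
  by rewrite -(heads_of _ _ cx) e.
apply: IH; rewrite /step cs /= -(heads_of _ _ cx) e // => i /=.
rewrite ffunE; have h := cx i; have [-> _ _] := h.
have -> : sel (tape_id_of i) (act u x) =
  view_act (sel (tape_id_of i) u) (sel (tape_id_of i) x).
  by case: (x) (u) (tape_id_of i) => [????? [????? []]].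
exact: represents_act.
Qed.

Lemma machine_of_answers (w : seq S) n b y :
  run F (Five (View (fun k => if k is i.+1 then omap inl (onth w i) else None) 1)
              (View (fun=> None) 1) (View (fun=> None) 1)
              (View (fun=> None) 1) (View (fun=> None) 1)) n b y ->
  answers_within machine_of w n b.
Proof.
move=> /run_machine; apply=> //= -[[|[|[|[|[|//]]]]] h];
  rewrite /tape_id_of /=; try exact: represents_blank.
rewrite (_ : (fun k => _) = (fun k => if k is i.+1 then
    onth [seq (inl s : S + W) | s <- w] i else None)).
  exact: represents_input.
apply: funext => -[|k] //=.
by elim: w k => [|a w IH] [|k] //=.
Qed.

End ToMachine.

(** * Polynomial bounds *)

Definition poly_bounded (f : nat -> nat) :=
  exists p : {poly nat}, forall n, f n <= p.[n]%R.

Lemma poly_bounded_const c : poly_bounded (fun=> c).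
Proof. by exists (c%:P)%R => n; rewrite hornerC. Qed.

Lemma poly_bounded_id : poly_bounded id.
Proof. by exists 'X%R => n; rewrite hornerX. Qed.

Lemma poly_bounded_add f g : poly_bounded f -> poly_bounded g ->
  poly_bounded (fun n => f n + g n).
Proof. by move=> [p hp] [q hq]; exists (p + q)%R => n; rewrite hornerD leq_add. Qed.

Lemma poly_bounded_mul f g : poly_bounded f -> poly_bounded g ->
  poly_bounded (fun n => f n * g n).
Proof. by move=> [p hp] [q hq]; exists (p * q)%R => n; rewrite hornerM leq_mul. Qed.

Lemma poly_bounded_succ f : poly_bounded f -> poly_bounded (fun n => (f n).+1).
Proof. exact: (poly_bounded_add (poly_bounded_const 1)). Qed.

(** * Relational programs over the positions of a word *)

(* Where column [j] lies relative to row [i]; in [PSucc b], where [j = i.+1],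
   [b] tells whether [i = 0]. *)
Inductive place := PEq | PSucc of bool | POther.

Definition place_of (i j : nat) : place :=
  if i == j then PEq else if j == i.+1 then PSucc (i == 0) else POther.

(** Both premises of a composition are to share their second argument: entry [(i, j)] then results
    from reading rows [i] and [j] in parallel, whereas a join in the middle would require reading a
    column. *)
Record rules (S Rel : finType) := Rules {
  rinit : option S -> option S -> place -> {set Rel};
  rcomp : Rel -> Rel -> Rel -> bool;
  rmeet : Rel -> Rel -> Rel -> bool }.

(* The positions of [w] range from 0 to [size w], the last one carrying no
   symbol. *)
Inductive der (S Rel : finType) (Z : rules S Rel) (w : seq S) :
    Rel -> nat -> nat -> Prop :=
| der_init r i j : i <= size w -> j <= size w ->
    r \in rinit Z (onth w i) (onth w j) (place_of i j) -> der Z w r i j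
| der_comp p q r i j k : rcomp Z p q r ->
    der Z w p i k -> der Z w q j k -> der Z w r i j
| der_meet p q r i j : rmeet Z p q r ->
    der Z w p i j -> der Z w q i j -> der Z w r i j.

(** * Contents of the tapes *)

Section Decide.
Variables (S Rel : finType) (Z : rules S Rel) (accept : Rel).
Implicit Types (w : seq S) (A B : {set Rel}) (X : nat -> nat -> {set Rel}).

Definition cut A B : {set Rel} :=
  [set r | [exists p in A, exists q in B, rcomp Z p q r]].

Definition local A : {set Rel} :=
  [set r | [exists p in A, exists q in A, rmeet Z p q r]].

Definition start w i j := rinit Z (onth w i) (onth w j) (place_of i j).

(** All new entries are computed from the old table, so the updated copy is kept apart from the two
    that are read. *)
Definition next N X i j : {set Rel} :=
  X i j :|: local (X i j) :|: \bigcup_(k < N) cut (X i k) (X j k).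

Local Notation work := ((option S * option bool) + option {set Rel})%type.
Local Notation sym := (S + work)%type.

(** The mark is [Some b], where [b] tells whether the marked position is 0. *)
Definition marked (s : option S) (m : option bool) : sym := inr (inl (s, m)).
Definition hash : sym := inr (inr None).
Definition cell A : sym := inr (inr (Some A)).

Definition in_cells w (p : nat) : option sym :=
  if p is i.+1 then omap inl (onth w i) else None.

Definition mark_cells w (i p : nat) : option sym :=
  if p is j.+1 then
    if j <= size w then
      Some (marked (onth w j) (if j == i then Some (i == 0) else None))
    else None
  else None.

(* The rows of the table one after the other, each one followed by [hash]. *)
Definition table N X (p : nat) : option sym :=
  if p is q.+1 then
    let i := q %/ N.+1 in let j := q %% N.+1 in
    if i < N then Some (if j < N then cell (X i j) else hash) else None
  else None.

(** The shift by one leaves cell 0 blank; column [N] holds the [hash]. *)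
Definition addr N i j := (i * N.+1 + j).+1.

Lemma table_cell N X i j : i < N -> j < N ->
  table N X (addr N i j) = Some (cell (X i j)).
Proof.
move=> iN jN; rewrite /table /addr divnMDl // divn_small; last lia.
by rewrite addn0 iN modnMDl modn_small ?jN //; lia.
Qed.

Lemma table_hash N X i : i < N -> table N X (addr N i N) = Some hash.
Proof.
move=> iN; rewrite /table /addr divnMDl // divn_small; last lia.
by rewrite addn0 iN modnMDl modn_small // ltnn.
Qed.

Lemma table_end N X p : addr N N 0 <= p -> table N X p = None.
Proof.
case: p => // p; rewrite /addr addn0 ltnS => h; rewrite /table.
have : N <= p %/ N.+1 by rewrite leq_divRL.
by case: ltnP.
Qed.

Lemma table_some N X p : 0 < p < addr N N 0 -> table N X p.
Proof.
case: p => // p; rewrite /addr addn0 ltnS /= => h.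
by have -> : p %/ N.+1 < N by rewrite ltn_divLR.
Qed.

Lemma addrS N i : addr N i.+1 0 = (addr N i N).+1.
Proof. by rewrite /addr; lia. Qed.

Local Arguments table : simpl never.
Local Arguments addr : simpl never.

Lemma addr_ind N p : 0 < p < addr N N 0 ->
  exists i j, [/\ i < N, j <= N & p = addr N i j].
Proof.
case: p => // p; rewrite /addr addn0 /= ltnS => h.
exists (p %/ N.+1), (p %% N.+1); split.
- by rewrite ltn_divLR.
- by rewrite -ltnS ltn_mod.
- by rewrite -divn_eq.
Qed.

Lemma table_eq N X Y :
  (forall i j, i < N -> j < N -> X i j = Y i j) -> table N X = table N Y.
Proof.
move=> XY; apply: funext => -[//|q]; rewrite /table; case: ifP => // iN.
by case: ifP => // jN; rewrite XY.
Qed.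

(** The contents of a tape during a sweep to the right: rewritten before address [m], old from there
    on. *)
Definition splice (m : nat) (f g : nat -> option sym) p :=
  if p < m then f p else g p.

Lemma splice_write (m : nat) f g c : f m = c ->
  (fun k => if k == m then c else splice m f g k) = splice m.+1 f g.
Proof.
move=> e; apply: funext => k; rewrite /splice ltnS [in RHS]leq_eqVlt.
by case: eqP => [->|].
Qed.

Lemma splice_all m f g : (forall k, m <= k -> f k = g k) -> splice m f g = f.
Proof. by move=> h; apply: funext => k; rewrite /splice; case: ltnP => // /h. Qed.

Lemma splice_none m f g : (forall k, k < m -> f k = g k) -> splice m f g = g.
Proof. by move=> h; apply: funext => k; rewrite /splice; case: ltnP => // /h. Qed.

(** * Building the initial table *)

Definition none : nat -> option sym := fun=> None.

Local Notation idle := (@idle sym).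
Local Notation keep d := (None, d).
Local Notation put c d := (Some (Some c), d).

(** The state is true only at the first cell, which receives the mark. The blank after the input is
    copied too, as the position without a symbol. *)
Definition Copy : prog sym :=
  @Prog _ bool true (fun b h =>
    let m := if b then Some true else None in
    match f_in h with
    | Some (inl s) => (inl false, Five (keep GoRight) (put (marked (Some s) m) GoRight) idle idle idle)
    | _ => (inr true, Five (keep GoLeft) (put (marked None m) Stay) idle idle idle)
    end).

Lemma run_Copy w x y z :
  run Copy (Five (View (in_cells w) 1) (View none 1) x y z) (size w).+1 true
    (Five (View (in_cells w) (size w)) (View (mark_cells w 0) (size w).+1) x y z).
Proof.
suff H m k : k + m = size w ->
  @runs _ Copy (k == 0) (Five (View (in_cells w) k.+1)
    (View (splice k.+1 (mark_cells w 0) none) k.+1) x y z) m.+1 true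
    (Five (View (in_cells w) (size w)) (View (mark_cells w 0) (size w).+1) x y z).
  have -> : View none 1 = View (splice 1 (mark_cells w 0) none) 1.
    by rewrite splice_none // => -[].
  exact: (H _ 0 (erefl _)).
elim: m k => [|m IH] k km.
  rewrite addn0 in km; apply: runs_stop_eq.
    by rewrite /= /view_head /= km onth_default.
  rewrite /= /view_act /= splice_write; last first.
    by rewrite /= leq_eqVlt km eqxx /= onth_default // -km; case: ifP.
  rewrite splice_all ?km // => -[//|p] /=.
  by move=> h; case: ifP => //; lia.
have [a ka] : exists a, onth w k = Some a.
  by have := onthTE w k; case: (onth w k) => [a|] /=; [exists a|lia].
apply: runs_step_eq.
- by rewrite /= /view_head /= ka.
- rewrite /= /view_act /= splice_write // /=.
  have -> : k <= size w by lia.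
  by rewrite ka; case: ifP.
- by apply: (IH k.+1); lia.
Qed.

Definition input_symbol (c : option sym) : option S :=
  if c is Some (inl s) then Some s else None.

(* The state is [Some b] just after the marked cell, [b] telling whether the
   latter is the first cell; the mark moves one cell to the right. *)
Definition Row : prog sym :=
  @Prog _ (option bool) None (fun st h =>
    match f_mark h with
    | Some (inr (inl (s, m))) =>
      let pl := match m, st with
                | Some _, _ => PEq
                | None, Some b => PSucc b
                | None, None => POther end in
      let c := cell (rinit Z (input_symbol (f_in h)) s pl) in
      (inl m, Five idle (put (marked s (omap (fun=> false) st)) GoRight)
                (put c GoRight) (put c GoRight) (put c GoRight))
    | _ => (inr (isSome (f_in h)),
            Five idle (keep GoLeft) (put hash GoRight) (put hash GoRight) (put hash GoRight))
    end).

Definition building w q := View (splice q (table (size w).+1 (start w)) none) q.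

Lemma run_Row w i (N := (size w).+1) (t := fun j => building w (addr N i j)) :
  i <= size w ->
  run Row (Five (View (in_cells w) i.+1) (View (mark_cells w i) 1) (t 0) (t 0) (t 0))
    N.+1 (i < size w)
    (Five (View (in_cells w) i.+1) (View (mark_cells w i.+1) N)
       (building w (addr N i.+1 0)) (building w (addr N i.+1 0))
       (building w (addr N i.+1 0))).
Proof.
move=> iw; have iN : i < N by [].
(* The state is [Some] exactly in column [i.+1], which is how [Row] recognizes the successor of
   [i]. *)
suff H m j : j + m = N ->
  @runs _ Row (if j == i.+1 then Some (i == 0) else None)
    (Five (View (in_cells w) i.+1)
       (View (splice j.+1 (mark_cells w i.+1) (mark_cells w i)) j.+1) (t j) (t j) (t j))
    m.+1 (i < size w)
    (Five (View (in_cells w) i.+1) (View (mark_cells w i.+1) N)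
       (building w (addr N i.+1 0)) (building w (addr N i.+1 0))
       (building w (addr N i.+1 0))).
  have -> : View (mark_cells w i) 1 =
            View (splice 1 (mark_cells w i.+1) (mark_cells w i)) 1.
    by rewrite splice_none // => -[].
  exact: (H _ 0 (erefl _)).
elim: m j => [|m IH] j jm.
  rewrite addn0 in jm; apply: runs_stop_eq.
    rewrite /= /view_head /= /splice ltnn /= jm ltnn.
    by rewrite -[in RHS]onthTE; case: (onth w i).
  rewrite /= /view_act /= /building /= splice_all; last first.
    by move=> [//|p] /= h; case: ifP => //; lia.
  by rewrite splice_write ?jm ?table_hash // addrS.
have jw : j <= size w by lia.
apply: runs_step_eq.
- by rewrite /= /view_head /= /splice ltnn /= jw.
- rewrite /= /view_act /= splice_write; last first.
    rewrite /= jw; case: eqP => //=.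
  rewrite splice_write; last first.
    rewrite table_cell // /start /place_of; congr (Some (cell (rinit _ _ _ _))).
      by case: (onth w i).
    rewrite eq_sym; case: eqP => // _; by case: eqP.
  reflexivity.
- have := IH j.+1; rewrite eqSS => h.
  have e : addr N i j.+1 = (addr N i j).+1 by rewrite /addr addnS.
  move: h; rewrite /t e; apply; lia.
Qed.

(** [Move] answers true, which keeps the loop going as long as [Row] reports a further row. *)
Definition Build : prog sym :=
  Loop (If Row (Seq (Rewind _ TMark) (Move _ TIn GoRight)) (Answer _ false)).

Lemma run_Build w (N := (size w).+1) (t := building w (addr N 0 0))
    (v := View (table N (start w)) (addr N N 0)) :
  exists y, run Build
    (Five (View (in_cells w) 1) (View (mark_cells w 0) 1) t t t)
    (N * (N.+1 + (N.+1 + 1))) false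
    (Five (View (in_cells w) N) y v v v).
Proof.
exists (View (mark_cells w N) N).
pose x i := let t := building w (addr N i 0) in
  Five (View (in_cells w) i.+1) (View (mark_cells w i) 1) t t t.
have vE : v = building w (addr N N 0).
  by rewrite /building splice_all // => p; apply: table_end.
apply: (@run_Loop _ _ x) => [i iw|].
  apply: run_If; first exact/run_Row/ltnW.
  rewrite iw; apply: run_Seq.
    apply: (@run_Rewind _ TMark _ (mark_cells w i.+1) N) => // -[//|p] /= pN.
    by have -> : p <= size w by lia.
  exact: run_Move.
have := run_Row (leqnn (size w)); rewrite ltnn => h; rewrite vE.
(* The last iteration does not rewind; it is padded to the common bound. *)
apply: runs_widen (run_If h _); last exact: run_Answer.
by rewrite leq_add2l addn1.
Qed.

(** * One round of saturation *)

Definition is_cell (c : option sym) := if c is Some (inr (inr (Some _))) then true else false.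

Lemma cell_table N X i j : i < N -> j < N -> is_cell (table N X (addr N i j)).
Proof. by move=> iN jN; rewrite table_cell. Qed.

(* With tapes [TA] and [TB] at the starts of rows [i] and [j] and [TC] at entry
   [(i, j)], replaces this entry by its next value. *)
Definition Scan : prog sym :=
  @Prog _ {set Rel} finset.set0 (fun A h =>
    match f_a h, f_b h with
    | Some (inr (inr (Some B))), Some (inr (inr (Some B'))) =>
      (inl (A :|: cut B B'), Five idle idle (keep GoRight) (keep GoRight) idle)
    | _, _ =>
      let c := if f_c h is Some (inr (inr (Some B))) then cell (B :|: local B :|: A)
               else hash in
      (inr true, Five idle idle (keep GoLeft) (keep GoRight) (put c GoRight))
    end).

Lemma run_Scan N X i j x y g (t := table N X) : i < N -> j < N ->
  g (addr N i j) = Some (cell (X i j)) ->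
  run Scan
    (Five x y (View t (addr N i 0)) (View t (addr N j 0)) (View g (addr N i j)))
    N.+1 true
    (Five x y (View t (i * N.+1 + N)) (View t (addr N j.+1 0))
       (View (fun k => if k == addr N i j then Some (cell (next N X i j)) else g k)
          (addr N i j).+1)).
Proof.
move=> iN jN gE.
(* The state accumulates the cuts of the first [k] columns. *)
suff H m k : k + m = N ->
  @runs _ Scan (\bigcup_(l < k) cut (X i l) (X j l))
    (Five x y (View t (addr N i k)) (View t (addr N j k)) (View g (addr N i j)))
    m.+1 true
    (Five x y (View t (i * N.+1 + N)) (View t (addr N j.+1 0))
       (View (fun k => if k == addr N i j then Some (cell (next N X i j)) else g k)
          (addr N i j).+1)).
  by have := H N 0 (erefl _); rewrite big_ord0.
elim: m k => [|m IH] k km.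
  rewrite addn0 in km; rewrite km; apply: runs_stop_eq.
    by rewrite /= /view_head /= /t table_hash // gE.
  have eA : addr N i N = (i * N.+1 + N).+1 by [].
  by rewrite /= /view_act /view_head addrS eA /= gE.
have kN : k < N by lia.
apply: runs_step_eq.
- by rewrite /= /view_head /= /t !table_cell.
- rewrite /= /view_act /=. reflexivity.
- have := IH k.+1; rewrite big_ord_recr /= => h.
  have e l : addr N l k.+1 = (addr N l k).+1 by rewrite /addr addnS.
  by move: h; rewrite !e; apply; lia.
Qed.

(** [Scan] leaves [TB] at the next row and [TC] at the next entry; only [TA] has to return to the
    start of its row. *)
Definition Entry : prog sym :=
  Seq Scan (Seq (Sweep TA is_cell GoLeft GoRight) (Test (fun h => isSome (f_b h)))).

(** After the last entry of a row, [TA] and [TC] step over its [hash] into the next row, while [TB]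
    returns to row 0. *)
Definition Line : prog sym :=
  Seq (Loop Entry) (Seq (Sweep TA is_cell GoRight GoRight)
    (Seq (Move _ TC GoRight) (Seq (Back _ TB) (Test (fun h => isSome (f_a h)))))).

Definition Round : prog sym := Seq (Loop Line) (Seq (Back _ TA) (Back _ TC)).

Definition partial N X i j :=
  View (splice (addr N i j) (table N (next N X)) (table N X)) (addr N i j).

Lemma run_Entry N X i j x y (t := table N X) : i < N -> j < N ->
  run Entry
    (Five x y (View t (addr N i 0)) (View t (addr N j 0)) (partial N X i j))
    (N.+1 + (N.+1 + 1)) (j.+1 < N)
    (Five x y (View t (addr N i 0)) (View t (addr N j.+1 0)) (partial N X i j.+1)).
Proof.
move=> iN jN.
have g1 : splice (addr N i j) (table N (next N X)) (table N X) (addr N i j) =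
    Some (cell (X i j)).
  by rewrite /splice ltnn table_cell.
apply: run_Seq; first exact: (run_Scan x y iN jN g1).
rewrite splice_write ?table_cell //.
have -> : (addr N i j).+1 = addr N i j.+1 by rewrite /addr addnS.
set u := View (splice _ _ _) _; rewrite -/(partial N X i j.+1) in u *.
apply: run_Seq.
  apply: (@run_Sweep _ TA is_cell GoLeft GoRight _
            (fun k => View t (i * N.+1 + N - k)) N) => //=.
  - by rewrite subn0.
  - move=> k kN; rewrite /view_head /=; split.
      have -> : i * N.+1 + N - k = addr N i (N - k.+1) by rewrite /addr; lia.
      by apply: cell_table => //; lia.
    have -> : i * N.+1 + N - k = (i * N.+1 + N - k.+1).+1 by lia.
    by [].
  (* Before row [i] comes the blank at address 0 if [i = 0], and the [hash] of the previous row
     otherwise. *)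
  - rewrite /view_head /= addnK; case: i {g1 u} iN => [|i] iN //.
    have -> : i.+1 * N.+1 = addr N i N by rewrite /addr; lia.
    by rewrite /t table_hash //; lia.
have -> : (j.+1 < N) = isSome (table N X (addr N j.+1 0)).
  apply/idP/idP => h; first by rewrite table_cell //; lia.
  by rewrite ltnNge; apply/negP => Nj; rewrite table_end // /addr in h; nia.
rewrite /= addnK -/(addr N i 0); last first.
have -> : (i * N.+1).+1 = addr N i 0 by rewrite /addr addn0.
exact: run_Test.
Qed.

Definition line_time N := N * (N.+1 + (N.+1 + 1)) + (N.+1 + (1 + ((N * N.+1).+2 + 1))).

Lemma addr_lt N i : (addr N i 0 < addr N N 0) = (i < N).
Proof. by rewrite /addr !addn0 ltnS ltn_mul2r. Qed.

Lemma table_row_some N X i : isSome (table N X (addr N i 0)) = (i < N).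
Proof.
case: (ltnP i N) => h; first by rewrite table_some // addr_lt h.
by rewrite table_end // leqNgt addr_lt -leqNgt.
Qed.

Lemma addr_NN N : addr N N 0 = (N * N.+1).+1.
Proof. by rewrite /addr addn0. Qed.

Lemma table_some_le N X k : 0 < k <= N * N.+1 -> table N X k.
Proof. by move=> h; apply: table_some; rewrite addr_NN ltnS. Qed.

Lemma run_Line N X i x y (t := table N X) : 0 < N -> i < N ->
  run Line (Five x y (View t (addr N i 0)) (View t 1) (partial N X i 0))
    (line_time N) (i.+1 < N)
    (Five x y (View t (addr N i.+1 0)) (View t 1) (partial N X i.+1 0)).
Proof.
move=> N0 iN; apply: run_Seq.
  have -> : N * (N.+1 + (N.+1 + 1)) = N.-1.+1 * (N.+1 + (N.+1 + 1)) by rewrite prednK.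
  apply: (@run_Loop _ _ (fun j => Five x y (View t (addr N i 0))
            (View t (addr N j 0)) (partial N X i j))) => [j jN|].
    have jN1 : j.+1 < N by lia.
    by have := run_Entry X x y iN (ltnW jN1); rewrite jN1.
  have h1 : N.-1 < N by lia.
  by have := run_Entry X x y iN h1; rewrite prednK // ltnn; apply.
apply: run_Seq.
  apply: (@run_Sweep _ TA is_cell GoRight GoRight _
            (fun k => View t (addr N i k)) N) => //=.
    move=> k kN; rewrite /view_head /=; split; first exact: cell_table.
    by rewrite /addr addnS.
  by rewrite /view_head /= /t table_hash.
rewrite /= -addrS; apply: run_Seq; first exact: run_Move.
rewrite /= -addrS.
(* Stepping over the [hash] counts as rewriting it, since the old and the new table agree there. *)
have -> : splice (addr N i N) (table N (next N X)) (table N X) =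
  splice (addr N i.+1 0) (table N (next N X)) (table N X).
  rewrite addrS; apply: funext => k; rewrite /splice ltnS [in RHS]leq_eqVlt.
  by case: eqP => [->|//]; rewrite ltnn !table_hash.
apply: run_Seq.
  apply: (@run_Back _ TB _ t (N * N.+1)) => //=; last by move=> k; apply: table_some_le.
  by rewrite addr_NN.
by rewrite -(table_row_some N X); apply: run_Test.
Qed.

Definition round_time N := N * line_time N + ((N * N.+1).+2 + (N * N.+1).+2).

Lemma run_Round N X x y (t := table N X) : 0 < N ->
  exists b, run Round (Five x y (View t 1) (View t 1) (View t 1)) (round_time N) b
    (Five x y (View t 1) (View t 1) (View (table N (next N X)) 1)).
Proof.
move=> N0; exists false; apply: run_Seq.
  have -> : N * line_time N = N.-1.+1 * line_time N by rewrite prednK.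
  have -> : Five x y (View t 1) (View t 1) (View t 1) =
      Five x y (View t (addr N 0 0)) (View t 1) (partial N X 0 0).
    by rewrite /partial splice_none // => -[].
  apply: (@run_Loop _ _ (fun i => Five x y (View t (addr N i 0))
            (View t 1) (partial N X i 0))) => [i iN|].
    have iN1 : i.+1 < N by lia.
    by have := run_Line X x y N0 (ltnW iN1); rewrite iN1.
  have h1 : N.-1 < N by lia.
  by have := run_Line X x y N0 h1; rewrite prednK // ltnn; apply.
rewrite /partial splice_all; last by move=> k h; rewrite !table_end.
rewrite addr_NN; apply: run_Seq.
  by apply: (@run_Back _ TA _ t (N * N.+1)) => //= k; apply: table_some_le.
by apply: (@run_Back _ TC _ (table N (next N X)) (N * N.+1)) => //= k; apply: table_some_le.
Qed.

(** * Saturation and its running time *)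

Definition Sync : prog sym :=
  @Prog _ bool false (fun ch h =>
    if f_c h is Some c then
      (inl (ch || (f_a h != Some c)),
       Five idle idle (put c GoRight) (put c GoRight) (keep GoRight))
    else (inr ch, Five idle idle idle idle idle)).

(** Comparison and copying share one sweep: the old symbol on [TA] is inspected in the step that
    overwrites it. *)
Lemma run_Sync N X Y x y (t := table N X) (u := table N Y) :
  run Sync (Five x y (View t 1) (View t 1) (View u 1)) (N * N.+1).+1
    (has (fun k => t k != u k) (iota 1 (N * N.+1)))
    (Five x y (View u (addr N N 0)) (View u (addr N N 0)) (View u (addr N N 0))).
Proof.
suff H m k : k + m = N * N.+1 ->
  @runs _ Sync (has (fun k => t k != u k) (iota 1 k))
    (Five x y (View (splice k.+1 u t) k.+1) (View (splice k.+1 u t) k.+1) (View u k.+1))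
    m.+1 (has (fun k => t k != u k) (iota 1 (N * N.+1)))
    (Five x y (View u (addr N N 0)) (View u (addr N N 0)) (View u (addr N N 0))).
  have -> : View t 1 = View (splice 1 u t) 1 by rewrite splice_none // => -[].
  exact: (H _ 0 (erefl _)).
elim: m k => [|m IH] k km.
  rewrite addn0 in km; rewrite km; apply: runs_stop_eq.
    by rewrite /= /view_head /= -addr_NN /u table_end.
  rewrite splice_all -?addr_NN // => l h; rewrite /u /t !table_end //.
have uk : u k.+1 by apply: table_some_le; lia.
have {uk} [c ukc] : exists c, u k.+1 = Some c.
  by move: uk; case: (u k.+1) => [c|//]; exists c.
apply: runs_step_eq.
- by rewrite /= /view_head /= ukc.
- by rewrite /= /view_act /= splice_write.
- have e : iota 1 k.+1 = iota 1 k ++ [:: k.+1] by rewrite -[in LHS](addn1 k) iotaD add1n.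
  have := IH k.+1; rewrite e has_cat /= orbF.
  by rewrite [splice _ _ _ _]ifF ?ltnn // -ukc; apply; lia.
Qed.

Definition Backs : prog sym := Seq (Back _ TA) (Seq (Back _ TB) (Back _ TC)).

Definition backs_time N := (N * N.+1).+2 + ((N * N.+1).+2 + (N * N.+1).+2).

Lemma run_Backs N X x y (t := table N X) (v := View t (addr N N 0)) :
  run Backs (Five x y v v v) (backs_time N) false
    (Five x y (View t 1) (View t 1) (View t 1)).
Proof.
have tk k : 0 < k <= N * N.+1 -> t k by apply: table_some_le.
rewrite /v addr_NN; apply: run_Seq.
  by apply: (@run_Back _ TA _ t (N * N.+1)).
apply: run_Seq; first by apply: (@run_Back _ TB _ t (N * N.+1)).
by apply: (@run_Back _ TC _ t (N * N.+1)).
Qed.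

Definition Saturate : prog sym :=
  Loop (Seq Round (If Sync (Seq Backs (Answer _ true)) (Seq Backs (Answer _ false)))).

Definition saturate_time N :=
  round_time N + ((N * N.+1).+1 + (backs_time N + 1)).

(** A potential: every round that changes an entry lowers it, so it bounds the number of such
    rounds. *)
Definition missing N X := \sum_(i < N) \sum_(j < N) #|~: X i j|.

Lemma sub_next N X i j : X i j \subset next N X i j.
Proof. by rewrite /next -finset.setUA finset.subsetUl. Qed.

Lemma missing_next N X i j : i < N -> j < N -> X i j != next N X i j ->
  missing N (next N X) < missing N X.
Proof.
move=> iN jN neq.
have le k l : #|~: next N X k l| <= #|~: X k l|.
  by rewrite subset_leq_card // finset.setCS sub_next.
have lt : #|~: next N X i j| < #|~: X i j|.
  by rewrite proper_card // finset.properC finset.properEneq neq sub_next.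
rewrite /missing (bigD1 (Ordinal iN)) //= [leqRHS](bigD1 (Ordinal iN)) //=.
rewrite -addSn leq_add //; last by apply: leq_sum => k _; apply: leq_sum.
rewrite (bigD1 (Ordinal jN)) //= [leqRHS](bigD1 (Ordinal jN)) //=.
by rewrite -addSn leq_add //; apply: leq_sum.
Qed.

Lemma table_inj N X Y : (forall p, 0 < p <= N * N.+1 -> table N X p = table N Y p) ->
  forall i j, i < N -> j < N -> X i j = Y i j.
Proof.
move=> h i j iN jN.
have hp : 0 < addr N i j <= N * N.+1 by rewrite /addr; nia.
by have := h _ hp; rewrite !table_cell // => -[].
Qed.

Lemma run_Saturate N X x y : 0 < N ->
  exists Y, [/\ run Saturate
      (Five x y (View (table N X) 1) (View (table N X) 1) (View (table N X) 1))
      ((missing N X).+1 * saturate_time N) false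
      (Five x y (View (table N Y) 1) (View (table N Y) 1) (View (table N Y) 1)),
    forall i j, i < N -> j < N -> next N Y i j = Y i j &
    exists k, Y = iter k (next N) X].
Proof.
move=> N0; move e : (missing N X) => m.
elim/ltn_ind: m X e => m IH X e.
have [b0 hround] := run_Round X x y N0.
have hsync := run_Sync N X (next N X) x y.
have hbacks := run_Backs N (next N X) x y.
move: hsync => /=; set changed := has _ _ => hsync.
case E : changed hsync => hsync.
  have /hasP [p] := E; rewrite mem_iota add1n -addr_NN => hp neq.
  have [i [j [iN jN ep]]] := addr_ind hp.
  have jN' : j < N.
    rewrite ltn_neqAle jN andbT; apply: contra_neq neq => jN'.
    by rewrite ep jN' !table_hash.
  have {neq} neq : X i j != next N X i j.
    by apply: contra_neq neq => eX; rewrite ep !table_cell // -eX.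
  have lt := missing_next iN jN' neq; rewrite e in lt.
  have [Y [hY1 hY2 [k hY3]]] := IH _ lt _ (erefl _).
  exists Y; split=> //; last by exists k.+1; rewrite iterSr.
  apply: (@runs_widen _ _ _ _ (saturate_time N + (missing N (next N X)).+1 * saturate_time N)).
    by rewrite -mulSn leq_mul2r ltnS lt orbT.
  apply: run_Loop_next hY1.
  apply: run_Seq hround _; apply: run_If hsync _.
  exact: run_Seq hbacks (run_Answer _ _).
have same p : 0 < p <= N * N.+1 -> table N X p = table N (next N X) p.
  move=> hp; apply/eqP; apply: contraFT E => neq; apply/hasP; exists p => //.
  by rewrite mem_iota add1n ltnS.
exists X; split.
- apply: (@runs_widen _ _ _ _ (saturate_time N)); first by rewrite leq_pmull.
  (* Without a change both tables coincide, so the tapes end with [X] itself. The three occurrences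
     restored below are the initial tapes, where [hround] expects [X]. *)
  have -> : table N X = table N (next N X).
    by apply: table_eq; apply: table_inj.
  apply: run_Loop_stop; apply: run_Seq.
    rewrite -{1 2 3}(_ : table N X = table N (next N X)); first exact: hround.
    by apply: table_eq; apply: table_inj.
  apply: run_If hsync _; exact: run_Seq hbacks (run_Answer _ _).
- by move=> i j iN jN; rewrite -(table_inj same iN jN).
- by exists 0.
Qed.

(** * Correctness of the saturated table *)

Lemma der_bound w r i j : der Z w r i j -> i < (size w).+1 /\ j < (size w).+1.
Proof. by elim=> // [p q r' i' j' k _ _ [? ?] _ [? ?]]. Qed.

Lemma iter_next_sound w k : let N := (size w).+1 in
  forall r i j, i < N -> j < N -> r \in iter k (next N) (start w) i j -> der Z w r i j.
Proof.
move=> N; elim: k => [|k IH] r i j iN jN; first exact: der_init.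
rewrite /= {1}/next !finset.in_setU -orbA => /or3P[]; first exact: IH.
- rewrite finset.inE => /existsP [p] /andP [hp] /existsP [q] /andP [hq pqr].
  exact: der_meet pqr (IH _ _ _ iN jN hp) (IH _ _ _ iN jN hq).
- move=> /finset.bigcupP [l _]; rewrite finset.inE.
  move=> /existsP [p] /andP [hp] /existsP [q] /andP [hq pqr].
  exact: der_comp pqr (IH _ _ _ iN (ltn_ord l) hp) (IH _ _ _ jN (ltn_ord l) hq).
Qed.

Lemma next_fixed_complete w (Y : nat -> nat -> {set Rel}) (N := (size w).+1) :
  (forall i j, start w i j \subset Y i j) ->
  (forall i j, i < N -> j < N -> next N Y i j = Y i j) ->
  forall r i j, der Z w r i j -> r \in Y i j.
Proof.
move=> sY fY r i j; elim=> {r i j}.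
- by move=> r i j iN jN h; apply: (fintype.subsetP (sY i j)).
- move=> p q r i j k pqr hp IHp hq IHq.
  have [iN kN] := der_bound hp; have [jN _] := der_bound hq.
  rewrite -fY // /next !finset.in_setU; apply/orP; right.
  apply/finset.bigcupP; exists (Ordinal kN) => //; rewrite finset.inE.
  by apply/existsP; exists p; rewrite IHp; apply/existsP; exists q; rewrite IHq.
- move=> p q r i j pqr hp IHp hq IHq.
  have [iN jN] := der_bound hp.
  rewrite -fY // /next !finset.in_setU; apply/orP; left; apply/orP; right.
  rewrite finset.inE.
  by apply/existsP; exists p; rewrite IHp; apply/existsP; exists q; rewrite IHq.
Qed.

Lemma sub_iter_next N X k i j : X i j \subset iter k (next N) X i j.
Proof.
elim: k => [|k IH]; first exact: fintype.subxx.
exact: fintype.subset_trans IH (sub_next _ _ _ _).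
Qed.

(** At the end the head of [TC] is at address 1, the entry of [(0, 0)]. *)
Definition accepting (h : five (option sym)) :=
  if f_c h is Some (inr (inr (Some A))) then accept \in A else false.

Definition Decide : prog sym :=
  Seq Copy (Seq (Rewind _ TIn) (Seq (Rewind _ TMark) (Seq Build (Seq Backs (Seq Saturate
    (Test accepting)))))).

Definition decide_time N :=
  N + (N + (N.+1 + (N * (N.+1 + (N.+1 + 1)) + (backs_time N +
    ((N * (N * #|Rel|)).+1 * saturate_time N + 1))))).

Lemma run_Decide w : exists b y,
  run Decide (Five (View (in_cells w) 1) (View none 1) (View none 1)
                   (View none 1) (View none 1)) (decide_time (size w).+1) b y /\
  (b <-> der Z w accept 0 0).
Proof.
pose N := (size w).+1.
have [y hbuild] := run_Build w.
have [Y [hsat fY [k eY]]] := run_Saturate (start w) (View (in_cells w) N) y (ltn0Sn (size w)).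
exists (accept \in Y 0 0); eexists; split.
  apply: run_Seq; first exact: run_Copy.
  apply: run_Seq.
    apply: (@run_Rewind _ TIn _ (in_cells w) (size w)) => // -[//|p] /= pw.
    by have := onthTE w p; rewrite pw; case: (onth w p).
  apply: run_Seq.
    apply: (@run_Rewind _ TMark _ (mark_cells w 0) N) => // -[//|p] /= pw.
    by have -> : p <= size w by lia.
  apply: run_Seq.
    rewrite /= (_ : View none 1 = building w (addr N 0 0)); first exact: hbuild.
    by rewrite /building splice_none // => -[].
  apply: run_Seq; first exact: run_Backs.
  apply: run_Seq.
    (* Each of the [N * N] entries lacks at most [#|Rel|] names. *)
    apply: runs_widen hsat; rewrite leq_mul2r ltnS; apply/orP; right.
    have le : forall i : 'I_N, \sum_(j < N) #|~: start w i j| <= N * #|Rel|.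
      move=> i; rewrite -[X in X * _]card_ord -sum_nat_const.
      by apply: leq_sum => j _; apply: max_card.
    rewrite -[X in X * _]card_ord -sum_nat_const; exact: leq_sum.
  set T := Five _ _ _ _ _; have := run_Test accepting T.
  rewrite (_ : accepting (heads T) = (accept \in Y 0 0)); first exact.
  by rewrite /accepting /T /= /view_head /= div0n mod0n.
split=> [h|]; first by apply: (@iter_next_sound w k); rewrite -?eY.
apply: next_fixed_complete => // i j; rewrite eY; exact: sub_iter_next.
Qed.

Theorem der_decidable_in_PTIME : exists (M : machine S) (p : {poly nat}),
  forall w, exists b, answers_within M w p.[size w]%R b /\ (b <-> der Z w accept 0 0).
Proof.
have [p hp] : poly_bounded (fun n => decide_time n.+1).
  rewrite /decide_time /saturate_time /round_time /line_time /backs_time.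
  by repeat first [apply: poly_bounded_add | apply: poly_bounded_mul
    | apply: poly_bounded_succ | apply: poly_bounded_const | apply: poly_bounded_id].
exists (machine_of Decide), p => w.
have [b [y [h1 h2]]] := run_Decide w; exists b; split=> //.
apply: (@machine_of_answers _ _ _ _ _ _ y).
exact: runs_widen (hp _) h1.
Qed.

End Decide.

(** * A relational program for the consequence relation *)

(* A final [T] in a name denotes the converse relation. *)
Inductive rel :=
| rEq | rAny | rTT | rSu | rBi | rNa | rVe | rSB | rNN | rVV | rGAll | rGSome
| rGOr | rQAll | rQSome | rQOr | rET | rNxT | rBoT | rBo | rNx | rS1 | rS2
| rSm | rL | rLT | rSV | rZ1 | rZ2 | rGAllT | rDA | rGSomeT | rDS | rPS | rGOrT
| rDO | rPO | rIX | rIY | rDX | rDY | rD | rNDT | rW | rGT | rE0 | rBE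
| rQAllT | rQA | rQB | rQOrT | rQA2 | rQB2 | rQSomeT | rAQ | rSD | rAS | rAcc.

Definition all_rels : seq rel :=
  [:: rEq; rAny; rTT; rSu; rBi; rNa; rVe; rSB; rNN; rVV; rGAll; rGSome; rGOr;
      rQAll; rQSome; rQOr; rET; rNxT; rBoT; rBo; rNx; rS1; rS2; rSm; rL; rLT;
      rSV; rZ1; rZ2; rGAllT; rDA; rGSomeT; rDS; rPS; rGOrT; rDO; rPO; rIX; rIY;
      rDX; rDY; rD; rNDT; rW; rGT; rE0; rBE; rQAllT; rQA; rQB; rQOrT; rQA2;
      rQB2; rQSomeT; rAQ; rSD; rAS; rAcc].

Scheme Equality for rel.

Lemma rel_eqP : Equality.axiom rel_beq.
Proof.
move=> r s; apply: (iffP idP); first exact: internal_rel_dec_bl.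
exact: internal_rel_dec_lb.
Qed.

HB.instance Definition _ := hasDecEq.Build rel rel_eqP.

Lemma rel_indexK : cancel (index^~ all_rels) (nth rEq all_rels).
Proof. by case. Qed.

HB.instance Definition _ := Countable.copy rel (can_type rel_indexK).

Lemma all_relsP : Finite.axiom all_rels.
Proof. by case. Qed.

HB.instance Definition _ := isFinite.Build rel all_relsP.

Definition is_bit (s : option symbol) := if s is Some (Bit _) then true else false.
Definition is_succ (pl : place) := if pl is PSucc _ then true else false.
Definition is_term (s : option symbol) :=
  match s with Some NounTag | Some VerbTag => true | _ => false end.

Arguments is_term : simpl never.

(** The query starts at position 0, so [PSucc true] selects its tag and [PSucc false] the tags of
    the theory. [rET] and [rSm] start from empty names. *)
Definition initial (r : rel) (s t : option symbol) (pl : place) : bool :=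
  match r with
  | rEq => if pl is PEq then true else false
  | rAny => true
  | rTT => is_term s && is_term t
  | rSu => is_succ pl
  | rBi => is_succ pl && is_bit s
  | rNa => is_succ pl && (s == Some NounTag)
  | rVe => is_succ pl && (s == Some VerbTag)
  | rSB => is_bit s && (s == t)
  | rNN => (s == Some NounTag) && (t == Some NounTag)
  | rVV => (s == Some VerbTag) && (t == Some VerbTag)
  | rGAll => if pl is PSucc false then s == Some AllTag else false
  | rGSome => if pl is PSucc false then s == Some SomeTag else false
  | rGOr => if pl is PSucc false then s == Some OrTag else false
  | rQAll => if pl is PSucc true then s == Some AllTag else false
  | rQSome => if pl is PSucc true then s == Some SomeTag else false
  | rQOr => if pl is PSucc true then s == Some OrTag else false
  | rET => if pl is PEq then ~~ is_bit s else false
  | rSm => ~~ is_bit s && ~~ is_bit t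
  | _ => false
  end.

(* [(p, q, r)] stands for [r(i, j) :- p(i, k), q(j, k)]. *)
Definition comp_rules : seq (rel * rel * rel) :=
  [:: (rET, rBi, rET); (rET, rNa, rNxT); (rET, rVe, rBoT); (rEq, rBoT, rBo);
      (rNxT, rBo, rNxT); (rEq, rNxT, rNx); (rSu, rSm, rS1); (rS1, rSu, rS2);
      (rEq, rL, rLT); (rL, rLT, rL); (rBo, rL, rZ1); (rZ1, rBo, rZ2);
      (rEq, rGAll, rGAllT); (rGAllT, rGAllT, rDA); (rDA, rNxT, rL);
      (rEq, rGSome, rGSomeT); (rGSomeT, rGSomeT, rDS); (rDS, rNxT, rPS);
      (rEq, rGOr, rGOrT); (rGOrT, rGOrT, rDO); (rDO, rNxT, rPO);
      (rL, rIX, rDX); (rIX, rL, rDX); (rL, rIY, rDY); (rIY, rL, rDY);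
      (rNx, rNDT, rW); (rAny, rW, rGT); (rE0, rTT, rL); (rBo, rE0, rBE);
      (rTT, rBE, rL);
      (rEq, rQAll, rQAllT); (rAny, rQAllT, rQA); (rQA, rNxT, rQB);
      (rEq, rQOr, rQOrT); (rAny, rQOrT, rQA); (rAny, rQOrT, rQA2);
      (rQA2, rNxT, rQB2); (rQB2, rNxT, rIX);
      (rEq, rQSome, rQSomeT); (rAny, rQSomeT, rIX); (rIX, rNxT, rIY);
      (rQA, rLT, rAQ); (rAQ, rQB, rAcc); (rAny, rSD, rAS); (rAS, rAny, rAcc)].

(** [rSV] with [rZ2] is anti-monotonicity (equal verbs, comparable bodies); [rPO] with [rGT] is
    [le_or]. *)
Definition meet_rules : seq (rel * rel * rel) :=
  [:: (rS2, rSB, rSm); (rS2, rNN, rL); (rS2, rVV, rSV); (rSV, rZ2, rL);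
      (rDX, rDY, rD); (rNxT, rD, rNDT); (rPO, rGT, rL); (rEq, rD, rE0);
      (rPS, rD, rSD)].

Definition consequence_rules : rules symbol rel :=
  Rules (fun s t pl => [set r | initial r s t pl])
        (fun p q r => (p, q, r) \in comp_rules)
        (fun p q r => (p, q, r) \in meet_rules).

(** * Terms and sentences at positions of the encoding *)

Section Positions.
Variables (P R : Type) (nameP : P -> seq bool) (nameR : R -> seq bool).
Hypotheses (nameP_inj : injective nameP) (nameR_inj : injective nameR).
Variables (l : seq (sentence P R)) (f : sentence P R).
Implicit Types (x y z : term P R) (h : sentence P R).

Local Notation enc := (encode_term nameP nameR).
Local Notation encs := (encode_sentence nameP nameR).
Let w := encode nameP nameR (l, f).
Let G : theory P R := [set h | List.In h l]%classic.
Let D := T (G `|` [set f])%classic.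
Local Notation "x '<<=' y" := (le G f x y) (at level 70).

(** Names carry no terminator, so decoding is unique only when a name is followed by a non-bit or by
    the end of the word. *)
Definition no_bit (s : seq symbol) := ~~ is_bit (ohead s).

Lemma bits_cancel u v s t : no_bit s -> no_bit t ->
  map Bit u ++ s = map Bit v ++ t -> u = v /\ s = t.
Proof.
elim: u v => [|a u IH] [|b v] //= hs ht.
- by move=> e; rewrite e in hs.
- by move=> e; rewrite -e in ht.
- by case=> -> /(IH _ hs ht) [-> ->].
Qed.

Lemma no_bit_term x s : no_bit (enc x ++ s).
Proof. by case: x. Qed.

Lemma no_bit_terms (ts : seq (term P R)) s : no_bit s -> no_bit (flatten (map enc ts) ++ s).
Proof. by case: ts => //= x ts _; rewrite -catA no_bit_term. Qed.

Lemma no_bit_sentences hs : no_bit (flatten (map encs hs)).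
Proof. by case: hs => // -[]. Qed.

Lemma encode_term_cancel x y s t : no_bit s -> no_bit t ->
  enc x ++ s = enc y ++ t -> x = y /\ s = t.
Proof.
elim: x y => [p|r x IH] [q|q y] //= hs ht.
- by case=> /(bits_cancel hs ht) [/nameP_inj -> ->].
- case; rewrite -!catA => /bits_cancel [||/nameR_inj ->]; try exact: no_bit_term.
  by move=> /(IH _ hs ht) [-> ->].
Qed.

(* [no_bit s]: the name of the noun ends where [s] starts. *)
Definition At (i : nat) x := exists2 s, no_bit s & drop i w = enc x ++ s.

Definition len x := size (enc x).

Lemma At_inj i x y : At i x -> At i y -> x = y.
Proof.
move=> [s hs e] [t ht e']; rewrite e in e'.
by have [] := encode_term_cancel hs ht e'.
Qed.

Lemma drop_onth (s : seq symbol) i c : onth s i = Some c -> drop i s = c :: drop i.+1 s.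
Proof. by elim: s i => [|a s IH] [|i] //= => [[->]|/IH]; rewrite ?drop0. Qed.

Lemma onth_drop (s : seq symbol) i : onth s i = ohead (drop i s).
Proof. by elim: s i => [|a s IH] [|i] /=. Qed.

Lemma drop_shift i (s t : seq symbol) : drop i w = s ++ t -> drop (i + size s) w = t.
Proof. by move=> e; rewrite addnC -drop_drop e drop_size_cat. Qed.

Lemma drop_bound i (s t : seq symbol) : s <> [::] -> drop i w = s ++ t ->
  i + size s <= size w.
Proof.
move=> s0 e; have := congr1 size e; rewrite size_drop size_cat.
by case: s s0 {e} => //= a s _; lia.
Qed.

Lemma At_bound i x : At i x -> i + len x <= size w.
Proof. by move=> [s _ /drop_bound]; apply; case: x. Qed.

Lemma At_tag i x : At i x ->
  onth w i = Some (match x with Noun _ => NounTag | RAll _ _ => VerbTag end).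
Proof. by move=> [s _ e]; rewrite onth_drop e; case: (x). Qed.

Lemma At_body i r x : At i (RAll r x) -> At (i + (size (nameR r)).+1) x.
Proof.
move=> [s hs] /= e; exists s => //.
have := @drop_shift i (VerbTag :: map Bit (nameR r)) (enc x ++ s).
by rewrite /= size_map; apply; rewrite e -catA.
Qed.

Lemma len_RAll r x : len (RAll r x) = (size (nameR r)).+1 + len x.
Proof. by rewrite /len /= size_cat size_map. Qed.

(** Apart from the bits of names, an encoded term consists of tags, each of which starts a
    subterm. *)
Lemma term_locate x s i c : no_bit s -> i < size (enc x) ->
  onth (enc x) i = Some c -> ~~ is_bit (Some c) ->
  is_term (Some c) /\
  exists2 y, subterm y x & exists2 t, no_bit t & drop i (enc x ++ s) = enc y ++ t.
Proof.
have bits u j : onth (map Bit u) j = Some c -> ~~ is_bit (Some c) -> False.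
  by elim: u j => [|b u IH] [|j] //=; [case=> <-|apply: IH].
elim: x i => [p|r x IH] [|i] /= hs hi hc nc.
- case: hc => <-; split=> //; exists (Noun p); first by left.
  by exists s => //; rewrite drop0.
- by case: (bits _ _ hc nc).
- case: hc => <-; split=> //; exists (RAll r x); first by left.
  by exists s => //; rewrite drop0.
- move: hc; rewrite onth_cat size_map; case: ltnP => h hc.
    by case: (bits _ _ hc nc).
  move: hi; rewrite size_cat size_map ltnS -ltn_subLR // => hi.
  have [ct [y yx [t ht e]]] := IH _ hs hi hc nc; split=> //.
  exists y; first by right.
  exists t => //; rewrite -catA drop_cat size_map ltnNge h /=; exact: e.
Qed.

Lemma terms_locate (ts : seq (term P R)) s i c : no_bit s -> i < size (flatten (map enc ts)) ->
  onth (flatten (map enc ts)) i = Some c -> ~~ is_bit (Some c) ->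
  is_term (Some c) /\ exists y x, [/\ List.In x ts, subterm y x &
    exists2 t, no_bit t & drop i (flatten (map enc ts) ++ s) = enc y ++ t].
Proof.
move=> hs; elim: ts i => [|x ts IH] i //=.
rewrite size_cat onth_cat => hi; case: ltnP => h hc nc.
  have [ct [y yx [t ht e]]] := term_locate (no_bit_terms ts hs) h hc nc.
  by split=> //; exists y, x; split; [left|done|exists t => //; rewrite -catA].
have [|ct [y [z [hz yz [t ht e]]]]] := IH _ _ hc nc; first by lia.
split=> //; exists y, z; split; [by right|done|exists t => //].
by rewrite -catA drop_cat ltnNge h.
Qed.

Definition sentence_tag h :=
  match h with SAll _ _ => AllTag | SSome _ _ => SomeTag | SOr _ _ _ _ => OrTag end.

Lemma encode_sentenceE h :
  encs h = sentence_tag h :: flatten (map enc (sentence_terms h)).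
Proof. by case: h => [a b|a b|a b c d] /=; rewrite ?cats0. Qed.

Definition Sent s h := exists2 t, no_bit t & drop s w = encs h ++ t.

(** The list [hs1] of preceding sentences later tells the query from the theory: it is empty exactly
    for the first sentence. *)
Lemma sentences_locate hs i c : onth (flatten (map encs hs)) i = Some c ->
  ~~ is_bit (Some c) ->
  if is_term (Some c) then
    exists y x h, [/\ List.In h hs, List.In x (sentence_terms h), subterm y x &
      exists2 t, no_bit t & drop i (flatten (map encs hs)) = enc y ++ t]
  else
    exists h hs1 hs2, [/\ hs = hs1 ++ h :: hs2, i = size (flatten (map encs hs1)),
      c = sentence_tag h &
      drop i (flatten (map encs hs)) = encs h ++ flatten (map encs hs2)].
Proof.
elim: hs i => [|h hs IH] i; first by case: i.
rewrite /= onth_cat; case: ltnP => hi hc nc.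
  move: hi hc; rewrite encode_sentenceE; case: i => [|i] /= hi hc.
    have -> : is_term (Some c) = false by case: hc => <-; case: (h).
    exists h, [::], hs; split=> //; first by case: hc.
    by rewrite encode_sentenceE.
  have [-> [y [x [hx yx [t ht e]]]]] := terms_locate (no_bit_sentences hs) hi hc nc.
  exists y, x, h; split=> //; first by left.
  by exists t.
have := IH _ hc nc; case: ifP => _.
  move=> [y [x [h' [hh hx yx [t ht e]]]]]; exists y, x, h'; split=> //; first by right.
  by exists t => //; rewrite drop_cat ltnNge hi.
move=> [h' [hs1 [hs2 [e1 e2 e3 e4]]]]; exists h', (h :: hs1), hs2; split=> //.
- by rewrite e1.
- by rewrite /= size_cat -e2 subnKC.
- by rewrite drop_cat ltnNge hi.
Qed.

Lemma wE : w = flatten (map encs (f :: l)).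
Proof. by []. Qed.

Lemma term_at i : is_term (onth w i) -> exists2 x, At i x & D x.
Proof.
case e : (onth w i) => [c|//] hc.
have nc : ~~ is_bit (Some c) by case: c hc {e}.
have := sentences_locate (hs := f :: l) e nc; rewrite hc.
move=> [y [x [h [hh hx yx [t ht e']]]]]; exists y; first by exists t.
exists h; split; last by exists x.
by case: hh => [<-|]; [right|left].
Qed.

Lemma At_D i x : At i x -> D x.
Proof.
move=> h; have [|y hy Dy] := @term_at i; first by rewrite (At_tag h); case: (x).
by rewrite (At_inj h hy).
Qed.

Lemma sentence_at s c : onth w s = Some c -> ~~ is_bit (Some c) -> ~~ is_term (Some c) ->
  exists h, [/\ c = sentence_tag h, Sent s h & if s == 0 then h = f else G h].
Proof.
move=> e nc nt; have := sentences_locate (hs := f :: l) e nc; rewrite (negbTE nt).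
move=> [h [hs1 [hs2 [e1 e2 e3 e4]]]]; exists h; split=> //.
  by exists (flatten (map encs hs2)) => //; apply: no_bit_sentences.
case: hs1 e1 e2 => [|h0 hs1] /= [ef el] es; first by rewrite es.
have -> : (s == 0) = false by rewrite es encode_sentenceE.
by rewrite /G /= el; apply/List.in_or_app; right; left.
Qed.

Lemma Sent_theory h : G h -> exists2 s, 0 < s & Sent s h.
Proof.
rewrite /G /= => hin; have [l1 [l2 e]] := List.in_split _ _ hin.
exists (size (encs f ++ flatten (map encs l1))).
  by rewrite encode_sentenceE.
exists (flatten (map encs l2)); first exact: no_bit_sentences.
rewrite wE /= e (_ : app l1 _ = l1 ++ h :: l2) // map_cat flatten_cat /= catA.
by rewrite drop_size_cat.
Qed.

Lemma Sent_query : Sent 0 f.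
Proof.
by exists (flatten (map encs l)); [apply: no_bit_sentences|rewrite drop0].
Qed.

Lemma Sent_tag s h : Sent s h -> onth w s = Some (sentence_tag h).
Proof. by move=> [t _ e]; rewrite onth_drop e encode_sentenceE. Qed.

Fixpoint At_list i (ts : seq (term P R)) :=
  if ts is x :: ts then At i x /\ At_list (i + len x) ts else True.

Lemma Sent_terms s h : Sent s h -> At_list s.+1 (sentence_terms h).
Proof.
move=> [t ht]; rewrite encode_sentenceE -cat1s -catA => /drop_shift.
rewrite addn1; elim: (sentence_terms h) s.+1 => //= x ts IH i; rewrite -catA => e.
split; first by exists (flatten (map enc ts) ++ t) => //; apply: no_bit_terms.
exact/IH/drop_shift.
Qed.

(** This supplies a position for the middle term of a transitivity step. *)
Lemma D_At x : D x -> exists i, At i x.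
Proof.
have sub y z i : subterm y z -> At i z -> exists j, At j y.
  elim: z i => [p|r z IH] i /= [->|//]; try by exists i.
  by move=> yz /At_body /IH; apply.
move=> [h [hG [t [ht xt]]]].
have [s] : exists s, Sent s h.
  case: hG => [/Sent_theory [s _]|->]; first by exists s.
  by exists 0; apply: Sent_query.
move=> /Sent_terms; elim: (sentence_terms h) (s.+1) ht => //= z ts IH i [->|].
  by move=> [/(sub _ _ _ xt)].
by move=> /IH hts [_ /hts].
Qed.

(** * The intended meaning of the relations *)

Definition reads i u := exists2 s, no_bit s & drop i w = map Bit u ++ s.
Definition same_bits i j := exists2 u, reads i u & reads j u.
Definition gtag c s a := [/\ a = s.+1, s != 0 & onth w s = Some c].
Definition qtag c s a := [/\ a = 1, s = 0 & onth w 0 = Some c].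
Definition next_term i j := exists2 x, At i x & j = i + len x.
Definition body i k :=
  exists r y, [/\ At i (RAll r y), At k y & k = i + (size (nameR r)).+1].
Definition leq_at i j := exists x y, [/\ At i x, At j y & x <<= y].
Definition first_term c a :=
  exists h, [/\ G h, sentence_tag h = c & At_list a (sentence_terms h)].
Definition below_x t u :=
  exists x y v, [/\ some_part f x y, At t v \/ At u v & v <<= x].
Definition below_y t u :=
  exists x y v, [/\ some_part f x y, At t v \/ At u v & v <<= y].
Definition blocked t u := below_x t u /\ below_y t u.
Definition some_at t u := exists x y, [/\ G (SSome x y), At t x & At u y].
(** If [b] is the position of the second term of a disjunction, the next two terms are those of its
    some-part; the side condition of [le_or] thus becomes a condition on [b]. *)
Definition followed_by_blocked b u := exists y z,
  [/\ At b y, At (b + len y) z, u = b + len y + len z & blocked u (b + len y)].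

(** The invariant for soundness. Properties of one position either leave the first argument free, as
    [rIX] and [rGT] do, or sit on the diagonal, as [rDA] and [rE0] do. *)
Definition meaning (r : rel) (i j : nat) : Prop :=
  match r with
  | rEq => i = j
  | rAny => True
  | rTT => is_term (onth w i) /\ is_term (onth w j)
  | rSu => j = i.+1
  | rBi => j = i.+1 /\ is_bit (onth w i)
  | rNa => j = i.+1 /\ onth w i = Some NounTag
  | rVe => j = i.+1 /\ onth w i = Some VerbTag
  | rSB => is_bit (onth w i) /\ onth w i = onth w j
  | rNN => onth w i = Some NounTag /\ onth w j = Some NounTag
  | rVV => onth w i = Some VerbTag /\ onth w j = Some VerbTag
  | rGAll => gtag AllTag i j
  | rGSome => gtag SomeTag i j
  | rGOr => gtag OrTag i j
  | rQAll => qtag AllTag i j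
  | rQSome => qtag SomeTag i j
  | rQOr => qtag OrTag i j
  | rET => exists2 u, reads j u & i = j + size u
  | rNxT => next_term j i
  | rBoT => body j i
  | rBo => body i j
  | rNx => next_term i j
  | rS1 => same_bits i.+1 j
  | rS2 => same_bits i.+1 j.+1
  | rSm => same_bits i j
  | rL => leq_at i j
  | rLT => leq_at j i
  | rSV => same_bits i.+1 j.+1 /\ (onth w i = Some VerbTag /\ onth w j = Some VerbTag)
  | rZ1 => exists r y x, [/\ At i (RAll r y), At j x & x <<= y]
  | rZ2 => exists r y s x, [/\ At i (RAll r y), At j (RAll s x) & x <<= y]
  | rGAllT => gtag AllTag j i
  | rDA => i = j /\ first_term AllTag i
  | rGSomeT => gtag SomeTag j i
  | rDS => i = j /\ first_term SomeTag i
  | rPS => some_at i j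
  | rGOrT => gtag OrTag j i
  | rDO => i = j /\ first_term OrTag i
  | rPO => exists a b t u,
      [/\ G (SOr a b t u), At i a & At_list j [:: b; t; u]]
  | rIX => exists x y, some_part f x y /\ At_list j [:: x; y]
  | rIY => exists x y, some_part f x y /\ At j y
  | rDX => below_x i j
  | rDY => below_y i j
  | rD => blocked i j
  | rNDT => next_term j i /\ blocked i j
  | rW => followed_by_blocked i j
  | rGT => exists u, followed_by_blocked j u
  | rE0 => i = j /\ blocked i i
  | rBE => exists r y k, [/\ At i (RAll r y), At k y & blocked k k]
  | rQAllT => qtag AllTag j i
  | rQA => exists a b, all_part f a b /\ At_list j [:: a; b]
  | rQB => exists a b, all_part f a b /\ At j b
  | rQOrT => qtag OrTag j i
  | rQA2 => exists a b x y, some_part f x y /\ At_list j [:: a; b; x; y]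
  | rQB2 => exists b x y, some_part f x y /\ At_list j [:: b; x; y]
  | rQSomeT => qtag SomeTag j i
  | rAQ => exists a b z, [/\ all_part f a b, At j z & a <<= z]
  | rSD => some_at i j /\ blocked i j
  | rAS => decided G f
  | rAcc => decided G f
  end.

(** * Soundness of the relational program *)

Lemma some_part_inj x y x' y' :
  some_part f x y -> some_part f x' y' -> x = x' /\ y = y'.
Proof. by rewrite /some_part; case: (f) => // [? ?|? ? ? ?] [-> ->] [-> ->]. Qed.

Lemma all_part_inj x y x' y' :
  all_part f x y -> all_part f x' y' -> x = x' /\ y = y'.
Proof. by rewrite /all_part; case: (f) => // [? ?|? ? ? ?] [-> ->] [-> ->]. Qed.

Lemma reads_inj i u v : reads i u -> reads i v -> u = v.
Proof.
move=> [s hs e] [t ht e']; rewrite e in e'.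
by have [] := bits_cancel hs ht e'.
Qed.

Lemma reads_cons i b u : onth w i = Some (Bit b) -> reads i.+1 u -> reads i (b :: u).
Proof. by move=> /drop_onth e [s hs e']; exists s; rewrite // e e'. Qed.

Lemma drop_S i c s : drop i w = c :: s -> drop i.+1 w = s.
Proof. by move=> e; rewrite -addn1 (@drop_shift i [:: c] s). Qed.

Lemma reads_noun i p : At i (Noun p) -> reads i.+1 (nameP p).
Proof. by move=> [s hs /= /drop_S e]; exists s. Qed.

Lemma reads_verb i r x : At i (RAll r x) -> reads i.+1 (nameR r).
Proof.
move=> [s hs /= /drop_S e]; exists (enc x ++ s); first exact: no_bit_term.
by rewrite catA.
Qed.

Lemma noun_at i : onth w i = Some NounTag -> exists p, At i (Noun p).
Proof.
move=> e; have [|x hx _] := @term_at i; first by rewrite e.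
by case: x hx (At_tag hx) => [p hp|r x _]; [exists p|rewrite e].
Qed.

Lemma verb_at i : onth w i = Some VerbTag -> exists r x, At i (RAll r x).
Proof.
move=> e; have [|x hx _] := @term_at i; first by rewrite e.
by case: x hx (At_tag hx) => [p _|r x hp]; [rewrite e|exists r, x].
Qed.

Lemma gtag_first c s a : ~~ is_bit (Some c) -> ~~ is_term (Some c) ->
  gtag c s a -> first_term c a.
Proof.
move=> nc nt [-> s0 hc]; have [h [-> hs]] := sentence_at hc nc nt.
by rewrite (negbTE s0) => Gh; exists h; split=> //; apply: Sent_terms.
Qed.

Lemma qtag_tag c s a : qtag c s a -> sentence_tag f = c.
Proof. by move=> [_ _]; rewrite (Sent_tag Sent_query) => -[]. Qed.

Lemma query_terms : At_list 1 (sentence_terms f).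
Proof. exact: Sent_terms Sent_query. Qed.

Lemma query_all c s a : qtag c s a -> c != SomeTag ->
  exists x y, all_part f x y /\ At_list a [:: x; y].
Proof.
move=> hq; have [-> _ _] := hq; move: (qtag_tag hq) query_terms => <-.
rewrite /all_part; case: (f) => //= [x y [? [? _]]|x y ? ? [? [? _]]] _;
  by exists x, y.
Qed.

Lemma blocked_at t i : At i t -> blocked i i ->
  exists x y, [/\ some_part f x y, t <<= x & t <<= y].
Proof.
move=> hi [[x [y [v [xy hv vx]]]] [x' [y' [v' [xy' hv' vy]]]]].
exists x, y; have [_ ey] := some_part_inj xy xy'; split=> //.
  by rewrite (@At_inj i t v) //; case: hv.
by rewrite ey (@At_inj i t v') //; case: hv'.
Qed.

Lemma some_blocked t u : some_at t u -> blocked t u -> decided G f.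
Proof.
move=> [a [b [Gab ta ub]]] [[x [y [v [xy hv vx]]]] [x' [y' [v' [xy' hv' vy]]]]].
have [_ ey] := some_part_inj xy xy'.
left; exists a, b, v, v', x, y; split=> //; last by rewrite ey.
split; [case: hv => hv|case: hv' => hv'].
- by left; apply: At_inj hv ta.
- by right; apply: At_inj hv ub.
- by left; apply: At_inj hv' ta.
- by right; apply: At_inj hv' ub.
Qed.

Lemma leq_at_trans i j k : leq_at i k -> leq_at k j -> leq_at i j.
Proof.
move=> [x [y [hx hy xy]]] [y' [z [hy' hz yz]]].
exists x, z; split=> //; apply: le_trans xy _.
by rewrite (At_inj hy hy').
Qed.

Lemma initial_sound r i j : initial r (onth w i) (onth w j) (place_of i j) -> meaning r i j.
Proof.
have succ b : place_of i j = PSucc b -> j = i.+1 /\ b = (i == 0).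
  by rewrite /place_of; case: eqP => // _; case: eqP => // -> [<-].
have eq : place_of i j = PEq -> i = j.
  by rewrite /place_of; case: eqP => // _; case: eqP.
case: r => //=.
- by case: (place_of i j) eq => // /(_ erefl).
- by move=> /andP.
- by case: (place_of i j) succ => // b /(_ _ erefl) [].
- by case: (place_of i j) succ => // b /(_ _ erefl) [].
- by case: (place_of i j) succ => // b /(_ _ erefl) [? _] /eqP.
- by case: (place_of i j) succ => // b /(_ _ erefl) [? _] /eqP.
- by move=> /andP [? /eqP].
- by move=> /andP [/eqP ? /eqP].
- by move=> /andP [/eqP ? /eqP].
- by case: (place_of i j) succ => // -[] // /(_ _ erefl) [? h] /eqP; split=> //; rewrite -h.
- by case: (place_of i j) succ => // -[] // /(_ _ erefl) [? h] /eqP; split=> //; rewrite -h.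
- by case: (place_of i j) succ => // -[] // /(_ _ erefl) [? h] /eqP; split=> //; rewrite -h.
- case: (place_of i j) succ => // -[] // /(_ _ erefl) [-> /esym/eqP ->] /eqP //.
- case: (place_of i j) succ => // -[] // /(_ _ erefl) [-> /esym/eqP ->] /eqP //.
- case: (place_of i j) succ => // -[] // /(_ _ erefl) [-> /esym/eqP ->] /eqP //.
- case: (place_of i j) eq => // /(_ erefl) <- h; exists [::]; last by rewrite addn0.
  by exists (drop i w) => //; rewrite /no_bit -onth_drop.
- move=> /andP [hi hj]; exists [::].
    by exists (drop i w) => //; rewrite /no_bit -onth_drop.
  by exists (drop j w) => //; rewrite /no_bit -onth_drop.
Qed.

Lemma first_termP i : first_term AllTag i ->
  exists x y, G (SAll x y) /\ At_list i [:: x; y].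
Proof. by case=> -[x y|x y|a b x y] [Gh // _ hi]; exists x, y. Qed.

(** One conjunct per rule, in the order of the list; [foldr_and_mem] turns this into a statement
    about members. *)
Lemma comp_rules_sound :
  foldr (fun t Q => (forall i j k, meaning t.1.1 i k -> meaning t.1.2 j k ->
    meaning t.2 i j) /\ Q) True comp_rules.
Proof.
rewrite /=.
split=> [i j k [u hu ->] [ek]|].
  case e : (onth w j) => [[b| | | | |]|] // _; subst k.
  by exists (b :: u); [apply: reads_cons|rewrite /= addSnnS].
split=> [i j k [u hu ->] [ek /noun_at [p hp]]|].
  subst k; exists (Noun p) => //; rewrite (reads_inj hu (reads_noun hp)).
  by rewrite /len /= size_map addSnnS.
split=> [i j k [u hu ->] [ek /verb_at [r [x hx]]]|].
  subst k; exists r, x; rewrite (reads_inj hu (reads_verb hx)) addSnnS.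
  by split=> //; apply: At_body.
split=> [i j k e h|]; first by rewrite /= e in h *.
split=> [i j k [x hx ->] [r [y [hy hk ek]]]|].
  exists (RAll r y) => //; rewrite (At_inj hx hk) len_RAll ek; lia.
split=> [i j k e h|]; first by rewrite /= e in h *.
split=> [i j k -> [u hj hk]|]; first by exists u.
split=> [i j k [u hi hk] e|]; first by exists u => //; rewrite -e.
split=> [i j k e h|]; first by rewrite /= e in h *.
split=> [i j k|]; first exact: leq_at_trans.
split=> [i j k [r [y [hy hk _]]] [x [z [hx hz xz]]]|].
  by exists r, y, x; split=> //; rewrite (At_inj hk hz).
split=> [i j k [r [y [x [hy hx xy]]]] [s [z [hz hk _]]]|].
  by exists r, y, s, x; rewrite {1}(At_inj hx hk).
split=> [i j k e h|]; first by rewrite /= e in h *.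
split=> [i j k h h'|].
  split; first by have [-> _ _] := h; have [-> _ _] := h'.
  exact: gtag_first h.
split=> [i j k [<- /first_termP [x [y [Gxy [hx [hy _]]]]]] [z hz ->]|].
  exists x, y; split=> //; last exact: le_all.
  by rewrite (At_inj hz hx).
split=> [i j k e h|]; first by rewrite /= e in h *.
split=> [i j k h h'|].
  split; first by have [-> _ _] := h; have [-> _ _] := h'.
  exact: gtag_first h.
split=> [i j k [<- [h [Gh et ht]]] [z hz ->]|].
  case: h et Gh ht => // t u _ Gtu [ht [hu _]]; exists t, u; split=> //.
  by rewrite (At_inj hz ht).
split=> [i j k e h|]; first by rewrite /= e in h *.
split=> [i j k h h'|].
  split; first by have [-> _ _] := h; have [-> _ _] := h'.
  exact: gtag_first h.
split=> [i j k [<- [h [Gh et ht]]] [z hz ->]|].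
  case: h et Gh ht => // a b t u _ Gs [ha hl]; exists a, b, t, u; split=> //.
  by rewrite (At_inj hz ha).
split=> [i j k [v [x [hv hx vx]]] [x' [y [xy [hx' _]]]]|].
  by exists x, y, v; split; [rewrite (At_inj hx hx')|left|].
split=> [i j k [x' [y [xy [hx' _]]]] [v [x [hv hx vx]]]|].
  by exists x, y, v; split; [rewrite (At_inj hx hx')|right|].
split=> [i j k [v [y [hv hy vy]]] [x [y' [xy hy']]]|].
  by exists x, y, v; split; [rewrite (At_inj hy hy')|left|].
split=> [i j k [x [y' [xy hy']]] [v [y [hv hy vy]]]|].
  by exists x, y, v; split; [rewrite (At_inj hy hy')|right|].
split=> [i j k [y hy ek] [[z hz ej] hb]|].
  by exists y, z; rewrite -ek.
split=> [i j k _ h|]; first by exists k.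
(* A blocked diagonal position carries a term that is empty once the some-part fails, hence lies
   below every term. *)
split=> [i j k [ek hb] [/term_at [y hy Dy] /term_at [t ht Dt]]|].
  subst k; have [x [x' [xx tx tx']]] := blocked_at ht hb.
  by exists t, y; split=> //; apply: le_empty xx tx tx'.
split=> [i j k [r [y [hy hk _]]] [ek hb]|]; first by subst k; exists r, y, j.
(* Dually, [RAll r y] with such a body [y] lies above every term. *)
split=> [i j k [/term_at [x hx Dx] _] [r [y [m [hy hm hb]]]]|].
  have [z [z' [zz yz yz']]] := blocked_at hm hb.
  exists x, (RAll r y); split=> //; apply: le_rall_empty zz yz yz' => //.
  exact: At_D hy.
split=> [i j k e h|]; first by rewrite /= e in h *.
split=> [i j k _ h|]; first exact: query_all h _.
split=> [i j k [a [b [ab [ha [hb _]]]]] [z hz ->]|].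
  by exists a, b; rewrite (At_inj hz ha).
split=> [i j k e h|]; first by rewrite /= e in h *.
split=> [i j k _ h|]; first exact: query_all h _.
split=> [i j k _ h|].
  have [-> _ _] := h; move: (qtag_tag h) query_terms; rewrite /some_part.
  by case: (f) => // a b x y _ hl; exists a, b, x, y.
split=> [i j k [a [b [x [y [xy [ha hl]]]]]] [z hz ->]|].
  by exists b, x, y; rewrite (At_inj hz ha).
split=> [i j k [b [x [y [xy [hb hl]]]]] [z hz ->]|].
  by exists x, y; rewrite (At_inj hz hb).
split=> [i j k e h|]; first by rewrite /= e in h *.
split=> [i j k _ h|].
  have [-> _ _] := h; move: (qtag_tag h) query_terms; rewrite /some_part.
  by case: (f) => // x y _ hl; exists x, y.
split=> [i j k [x [y [xy [hx [hy _]]]]] [z hz ->]|].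
  by exists x, y; rewrite (At_inj hz hx).
split=> [i j k [a [b [ab [ha _]]]] [a' [z [ha' hz az]]]|].
  by exists a, b, z; split=> //; rewrite (At_inj ha ha').
split=> [i j k [a [b [z [ab hz az]]]] [a' [b' [ab' hb']]]|].
  right; exists a, b; split=> //; have [_ ->] := all_part_inj ab ab'.
  by rewrite -(At_inj hz hb').
split=> [i j k _ [h h']|]; first exact: some_blocked h h'.
by split.
Qed.

Lemma meet_rules_sound :
  foldr (fun t Q => (forall i j, meaning t.1.1 i j -> meaning t.1.2 i j ->
    meaning t.2 i j) /\ Q) True meet_rules.
Proof.
rewrite /=.
split=> [i j [u hi hj] [hb e]|].
  case ei : (onth w i) hb => [[b| | | | |]|] // _.
  by exists (b :: u); apply: reads_cons; rewrite // -e.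
split=> [i j [u hi hj] [/noun_at [p hp] /noun_at [q hq]]|].
  exists (Noun p), (Noun q); split=> //.
  rewrite (nameP_inj (_ : nameP p = nameP q)); first exact/le_refl/At_D/hq.
  by rewrite -(reads_inj hi (reads_noun hp)) -(reads_inj hj (reads_noun hq)).
split=> [//|].
split=> [i j [[u hi hj] _] [r [y [s [x [hy hx xy]]]]]|].
  exists (RAll r y), (RAll s x); split=> //.
  have rs : r = s.
    apply: nameR_inj.
    by rewrite -(reads_inj hi (reads_verb hy)) -(reads_inj hj (reads_verb hx)).
  rewrite rs in hy *; exact: le_anti (At_D hx) (At_D hy) xy.
split=> [//|].
split=> [//|].
(* Unique decoding identifies the terms seen by [rPO] with those that [rGT] finds after the position
   of [b]. *)
split=> [i j [a [b [t [u [Gs ha [hb [ht [hu _]]]]]]]] [m [y [z [hy hz -> hbl]]]]|].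
  exists a, b; split=> //; have ey := At_inj hb hy.
  move: hbl => [[x1 [x2 [v [xx hv vx]]]] [x1' [x2' [v' [xx' hv' vx']]]]].
  have [_ ex] := some_part_inj xx xx'; rewrite -ex in vx'.
  rewrite -ey in hv hv' hz; have ez := At_inj ht hz; rewrite -ez in hv hv'.
  apply: le_or Gs xx _ _ vx vx'.
    by case: hv => [/(At_inj hu)|/(At_inj ht)] <-; [right|left].
  by case: hv' => [/(At_inj hu)|/(At_inj ht)] <-; [right|left].
split=> [i j -> //|].
by split.
Qed.

Lemma foldr_and_mem (T : eqType) (Q : T -> Prop) s :
  foldr (fun t Q' => Q t /\ Q') True s -> forall t, t \in s -> Q t.
Proof.
elim: s => //= a s IH [ha hs] t; rewrite inE => /orP [/eqP ->|] //.
exact: IH.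
Qed.

Lemma der_sound r i j : der consequence_rules w r i j -> meaning r i j.
Proof.
elim=> {r i j}.
- by move=> r i j _ _; rewrite /= finset.inE; apply: initial_sound.
- by move=> p q r i j k /(foldr_and_mem comp_rules_sound) h _ hp _ hq; apply: h hp hq.
- by move=> p q r i j /(foldr_and_mem meet_rules_sound) h _ hp _ hq; apply: h hp hq.
Qed.

(** * Completeness of the relational program *)

Local Notation derw := (der consequence_rules w).

Lemma derI r i j : i <= size w -> j <= size w ->
  initial r (onth w i) (onth w j) (place_of i j) -> derw r i j.
Proof. by move=> hi hj h; apply: der_init; rewrite // finset.inE. Qed.

Lemma derC p q r i j k : derw p i k -> derw q j k ->
  (p, q, r) \in comp_rules -> derw r i j.
Proof. by move=> hp hq h; apply: (@der_comp _ _ consequence_rules) h hp hq. Qed.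

Lemma derM p q r i j : derw p i j -> derw q i j ->
  (p, q, r) \in meet_rules -> derw r i j.
Proof. by move=> hp hq h; apply: (@der_meet _ _ consequence_rules) h hp hq. Qed.

Lemma place_refl i : place_of i i = PEq.
Proof. by rewrite /place_of eqxx. Qed.

Lemma place_succ i : place_of i i.+1 = PSucc (i == 0).
Proof. by rewrite /place_of eqxx ltn_eqF. Qed.

Lemma der_any i j : i <= size w -> j <= size w -> derw rAny i j.
Proof. by move=> hi hj; apply: derI. Qed.

Lemma der_eq i : i <= size w -> derw rEq i i.
Proof. by move=> hi; apply: derI; rewrite ?place_refl. Qed.

(** As both premises share their second argument, composing with [rEq] on the left yields the
    converse. *)
Lemma der_conv p q i j : (rEq, p, q) \in comp_rules -> derw p j i -> derw q i j.
Proof.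
move=> hpq h; apply: (derC _ h hpq); apply: der_eq.
by have [_] := der_bound h; rewrite ltnS.
Qed.

Lemma der_succ r i c : onth w i = Some c ->
  (forall t, initial r (Some c) t (PSucc (i == 0))) -> derw r i i.+1.
Proof.
move=> e h; have hi : i < size w by rewrite -onthTE e.
by apply: derI; rewrite ?place_succ ?e // ltnW.
Qed.

Lemma At_le i x : At i x -> i <= size w.
Proof. by move=> /At_bound; apply: leq_trans; apply: leq_addr. Qed.

(** The end of the name stays fixed while its start moves left bit by bit. *)
Lemma der_bits i u : i <= size w -> reads i u -> derw rET (i + size u) i.
Proof.
elim: u i => [|b u IH] i hi [s hs e].
  by rewrite addn0; apply: derI; rewrite // place_refl /= onth_drop e.
have ei : onth w i = Some (Bit b) by rewrite onth_drop e.
rewrite addnS -addSn; apply: (derC (p := rET) (q := rBi) (k := i.+1)) => //.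
  apply: IH; first by rewrite -onthTE ei.
  by exists s => //; apply: drop_S e.
by apply: der_succ ei _.
Qed.

Lemma onth_lt i c : onth w i = Some c -> i < size w.
Proof. by move=> e; rewrite -onthTE e. Qed.

Lemma der_body i r x : At i (RAll r x) -> derw rBo i (i + (size (nameR r)).+1).
Proof.
move=> hx; have e := At_tag hx.
apply: (der_conv (p := rBoT)) => //.
apply: (derC (p := rET) (q := rVe) (k := i.+1)) => //.
  by rewrite -addSnnS; apply: der_bits (onth_lt e) (reads_verb hx).
exact: der_succ e _.
Qed.

Lemma der_next i x : At i x -> derw rNxT (i + len x) i.
Proof.
elim: x i => [p|r x IH] i hx; have e := At_tag hx.
  apply: (derC (p := rET) (q := rNa) (k := i.+1)) => //; last exact: der_succ e _.
  rewrite /len /= size_map -addSnnS.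
  exact: der_bits (onth_lt e) (reads_noun hx).
rewrite len_RAll addnA.
exact: (derC (IH _ (At_body hx)) (der_body hx)).
Qed.

Lemma der_names i j : i < size w -> j < size w ->
  derw rSm j.+1 i.+1 -> derw rS2 i j.
Proof.
have succ k : k < size w -> derw rSu k k.+1.
  by move=> hk; apply: derI; rewrite ?place_succ // ltnW.
move=> hi hj h; apply: (derC (p := rS1) (q := rSu) (k := j.+1)) => //; last exact: succ.
by apply: (derC (p := rSu) (q := rSm) (k := i.+1)) => //; apply: succ.
Qed.

Lemma der_same_bits i j u : i <= size w -> j <= size w ->
  reads i u -> reads j u -> derw rSm i j.
Proof.
elim: u i j => [|b u IH] i j hi hj [s hs ei] [t ht ej].
  by apply: derI; rewrite // /= !onth_drop ei ej; apply/andP.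
have ei' : onth w i = Some (Bit b) by rewrite onth_drop ei.
have ej' : onth w j = Some (Bit b) by rewrite onth_drop ej.
apply: (derM (p := rS2) (q := rSB)) => //; last first.
  by apply: derI; rewrite // ei' ej' /= eqxx.
apply: der_names; [exact: onth_lt ei'|exact: onth_lt ej'|apply: IH].
- exact: onth_lt ej'.
- exact: onth_lt ei'.
- by exists t => //; apply: drop_S ej.
- by exists s => //; apply: drop_S ei.
Qed.

Lemma der_same_names i j u c d : onth w i = Some c -> onth w j = Some d ->
  reads i.+1 u -> reads j.+1 u -> derw rS2 i j.
Proof.
move=> /onth_lt hi /onth_lt hj hiu hju.
exact: der_names hi hj (der_same_bits hj hi hju hiu).
Qed.

(** [rZ1] passes from the tag at [i] to its body, [rZ2] does so on the other side as well. *)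
Lemma der_anti i j r x y : At i (RAll r y) -> At j (RAll r x) ->
  derw rL (j + (size (nameR r)).+1) (i + (size (nameR r)).+1) -> derw rL i j.
Proof.
move=> hi hj h; have ei := At_tag hi; have ej := At_tag hj.
apply: (derM (p := rSV) (q := rZ2)) => //.
  apply: (derM (p := rS2) (q := rVV)) => //.
    exact: der_same_names ei ej (reads_verb hi) (reads_verb hj).
  by apply: derI; rewrite ?(At_le hi) ?(At_le hj) // ei ej.
apply: (derC (p := rZ1) (q := rBo) _ (der_body hj)) => //.
exact: (derC (p := rBo) (q := rL) (der_body hi) h).
Qed.

(** Equal terms at different positions are matched by comparing nouns bit by bit and passing through
    verbs with [der_anti]. *)
Lemma der_refl x i j : At i x -> At j x -> derw rL i j.
Proof.
elim: x i j => [p|r x IH] i j hi hj; last first.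
  by apply: (der_anti hi hj); apply: IH; [apply: At_body hj|apply: At_body hi].
have ei := At_tag hi; have ej := At_tag hj.
apply: (derM (p := rS2) (q := rNN)) => //.
  exact: der_same_names ei ej (reads_noun hi) (reads_noun hj).
by apply: derI; rewrite ?(At_le hi) ?(At_le hj) // ei ej.
Qed.

Lemma der_trans i j k : derw rL i k -> derw rL k j -> derw rL i j.
Proof. by move=> h h'; apply: (derC (q := rLT) h) => //; apply: der_conv h'. Qed.

(** A fact found at one occurrence of the terms, say in a sentence of the theory, spreads to all
    occurrences. *)
Lemma der_L_at x y i j i' j' : At i x -> At j y -> At i' x -> At j' y ->
  derw rL i j -> derw rL i' j'.
Proof.
move=> hi hj hi' hj' h; apply: (der_trans (der_refl hi' hi)).
exact: (der_trans h (der_refl hj hj')).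
Qed.

Definition first_rel h :=
  match h with SAll _ _ => rDA | SSome _ _ => rDS | SOr _ _ _ _ => rDO end.

Lemma der_first s h : 0 < s -> Sent s h -> derw (first_rel h) s.+1 s.+1.
Proof.
move=> s0 /Sent_tag; have sn : (s == 0) = false by case: (s) s0.
case: h => /= [x y|x y|a b x y] e.
- have hs : derw rGAllT s.+1 s.
    by apply: (der_conv (p := rGAll)) => //; apply: der_succ e _; rewrite sn.
  exact: (derC hs hs).
- have hs : derw rGSomeT s.+1 s.
    by apply: (der_conv (p := rGSome)) => //; apply: der_succ e _; rewrite sn.
  exact: (derC hs hs).
- have hs : derw rGOrT s.+1 s.
    by apply: (der_conv (p := rGOr)) => //; apply: der_succ e _; rewrite sn.
  exact: (derC hs hs).
Qed.

(** The free first argument, filled by [rAny], lets [rIX] and [rIY] be joined with [rL] from any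
    row. *)
Lemma der_query_some x y : some_part f x y ->
  exists k, [/\ At_list k [:: x; y], forall j, j <= size w -> derw rIX j k &
    forall j, j <= size w -> derw rIY j (k + len x)].
Proof.
move=> xy; have et := Sent_tag Sent_query; move: xy query_terms et.
have IY k x' j : At k x' -> derw rIX j k -> derw rIY j (k + len x').
  by move=> hk h; apply: (derC h (der_next hk)).
rewrite /some_part; case: (f) => // [x' y'|a b x' y'] [-> ->] /=.
  move=> [hx [hy _]] et; have IX j : j <= size w -> derw rIX j 1.
    move=> hj; apply: (derC (p := rAny) (q := rQSomeT) (k := 0)) => //.
      exact: der_any.
    by apply: (der_conv (p := rQSome)) => //; apply: (@der_succ _ 0 _ et).
  by exists 1; split=> // j hj; apply: IY hx (IX _ hj).
move=> [ha [hb [hx [hy _]]]] et.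
have IX j : j <= size w -> derw rIX j (1 + len a + len b).
  move=> hj; apply: (derC (p := rQB2) _ (der_next hb)) => //.
  apply: (derC (p := rQA2) _ (der_next ha)) => //.
  apply: (derC (p := rAny) (q := rQOrT) (k := 0)) => //; first exact: der_any.
  by apply: (der_conv (p := rQOr)) => //; apply: (@der_succ _ 0 _ et).
by exists (1 + len a + len b); split=> // j hj; apply: IY hx (IX _ hj).
Qed.

Lemma der_query_all a b : all_part f a b ->
  exists k, [/\ At_list k [:: a; b], forall j, j <= size w -> derw rQA j k &
    forall j, j <= size w -> derw rQB j (k + len a)].
Proof.
move=> ab; have et := Sent_tag Sent_query; move: ab query_terms et.
have QB k x' j : At k x' -> derw rQA j k -> derw rQB j (k + len x').
  by move=> hk h; apply: (derC h (der_next hk)).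
rewrite /all_part; case: (f) => // [a' b'|a' b' x y] [-> ->] /=.
  move=> [ha [hb _]] et; have QA j : j <= size w -> derw rQA j 1.
    move=> hj; apply: (derC (p := rAny) (q := rQAllT) (k := 0)) => //.
      exact: der_any.
    by apply: (der_conv (p := rQAll)) => //; apply: (@der_succ _ 0 _ et).
  by exists 1; split=> // j hj; apply: QB ha (QA _ hj).
move=> [ha [hb _]] et; have QA j : j <= size w -> derw rQA j 1.
  move=> hj; apply: (derC (p := rAny) (q := rQOrT) (k := 0)) => //.
    exact: der_any.
  by apply: (der_conv (p := rQOr)) => //; apply: (@der_succ _ 0 _ et).
by exists 1; split=> // j hj; apply: QB ha (QA _ hj).
Qed.

Definition der_leq x y := forall i j, At i x -> At j y -> derw rL i j.

Lemma der_blocked i j v v' x y : some_part f x y -> i <= size w -> j <= size w ->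
  At i v \/ At j v -> At i v' \/ At j v' -> der_leq v x -> der_leq v' y ->
  derw rD i j.
Proof.
move=> /der_query_some [k [[hx [hy _]] IX IY]] hi hj hv hv' vx vy.
apply: (derM (p := rDX) (q := rDY)) => //.
  case: hv => hv.
    by apply: (derC (p := rL) (q := rIX) (vx _ _ hv hx) (IX _ hj)).
  by apply: (derC (p := rIX) (q := rL) (IX _ hi) (vx _ _ hv hx)).
case: hv' => hv'.
  by apply: (derC (p := rL) (q := rIY) (vy _ _ hv' hy) (IY _ hj)).
by apply: (derC (p := rIY) (q := rL) (IY _ hi) (vy _ _ hv' hy)).
Qed.

Lemma der_empty i a x y : some_part f x y -> At i a -> der_leq a x -> der_leq a y ->
  derw rE0 i i.
Proof.
move=> xy hi ax ay; have hle := At_le hi.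
apply: (derM (p := rEq) (q := rD)) => //; first exact: der_eq.
by apply: (der_blocked xy _ _ _ _ ax ay) => //; left.
Qed.

Lemma der_TT i j x y : At i x -> At j y -> derw rTT i j.
Proof.
move=> hi hj; apply: derI; rewrite ?(At_le hi) ?(At_le hj) //.
by rewrite (At_tag hi) (At_tag hj); case: (x); case: (y).
Qed.

Lemma der_le x y : x <<= y -> der_leq x y.
Proof.
elim=> {x y}.
- by move=> x _ i j; apply: der_refl.
- move=> x y z xy dxy yz dyz i j hi hj.
  have [k hk] := D_At (le_T xy).2.
  exact: der_trans (dxy _ _ hi hk) (dyz _ _ hk hj).
- move=> r x y _ _ _ dxy i j hi hj; apply: (der_anti hi hj).
  by apply: dxy; [apply: At_body hj|apply: At_body hi].
- move=> x y /Sent_theory [s s0 hs] i j hi hj.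
  have [hx [hy _]] := Sent_terms hs.
  apply: (der_L_at hx hy hi hj).
  exact: (derC (der_first s0 hs) (der_next hx)).
- move=> a b t u v v' x y /Sent_theory [s s0 hs] xy ev ev' _ vx _ vy i j hi hj.
  have [ha [hb [ht [hu _]]]] := Sent_terms hs.
  apply: (der_L_at ha hb hi hj).
  apply: (derM (p := rPO) (q := rGT)) => //.
    exact: (derC (der_first s0 hs) (der_next ha)).
  apply: (derC (p := rAny) (q := rW) (k := s.+1 + len a + len b + len t)) => //.
    by apply: der_any; [exact: At_le ha|exact: At_le hu].
  apply: (derC (p := rNx) (q := rNDT) (k := s.+1 + len a + len b)) => //.
    by apply: (der_conv (p := rNxT)) => //; apply: der_next.
  apply: (derM (p := rNxT) (q := rD)) => //; first exact: der_next.
  (* The positions are taken in the order [u], [t], hence the swapped sides. *)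
  apply: (der_blocked xy _ _ _ _ vx vy); rewrite ?(At_le ht) ?(At_le hu) //.
    by case: ev => ->; [right|left].
  by case: ev' => ->; [right|left].
- move=> a b x y _ _ xy _ ax _ ay i j hi hj.
  exact: (derC (der_empty xy hi ax ay) (der_TT hj hi)).
- move=> r a b x y _ _ xy _ ax _ ay i j hi hj.
  have hk := At_body hj.
  apply: (derC (p := rTT) (q := rBE) (der_TT hi hk) _) => //.
  exact: (derC (der_body hj) (der_empty xy hk ax ay)).
Qed.

Lemma der_complete : decided G f -> derw rAcc 0 0.
Proof.
case=> [[t [u [v [v' [x [y [/Sent_theory [s s0 hs] xy [ev ev'] vx vy]]]]]]]|].
  have [ht [hu _]] := Sent_terms hs.
  have hD : derw rD s.+1 (s.+1 + len t).
    apply: (der_blocked xy _ _ _ _ (der_le vx) (der_le vy));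
      rewrite ?(At_le ht) ?(At_le hu) //.
      by case: ev => ->; [left|right].
    by case: ev' => ->; [left|right].
  have hPS : derw rPS s.+1 (s.+1 + len t).
    exact: (derC (der_first s0 hs) (der_next ht) _).
  apply: (derC (p := rAS) (q := rAny) (k := s.+1)) => //; last first.
    by apply: der_any => //; apply: At_le ht.
  apply: (derC (p := rAny) (q := rSD) _ (derM hPS hD _)) => //.
  by apply: der_any => //; apply: At_le hu.
move=> [a [b [/der_query_all [k [[ha [hb _]] QA QB]] /der_le ab]]].
(* Row 0 is chosen because the verdict is read at [(0, 0)]. *)
apply: (derC (p := rAQ) (q := rQB) _ (QB 0 isT)) => //.
apply: (derC (p := rQA) (q := rLT) (QA 0 isT) _) => //.
by apply: (der_conv (p := rL)) => //; apply: ab.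
Qed.

End Positions.

Local Open Scope classical_set_scope.

Theorem theorem2p34 (P R : Type) :
  (forall (G : theory P R) (f : sentence P R),
      entails G f -> derives (g (G `|` [set f])) G f) /\
  (forall (nameP : P -> seq bool) (nameR : R -> seq bool),
      injective nameP -> injective nameR ->
      in_PTIME (encode nameP nameR) (@consequence P R)).
Proof.
split=> [G f /entails_decided/decided_derives //|nameP nameR hP hR].
have [M [p h]] := der_decidable_in_PTIME consequence_rules rAcc.
exists M, p => -[l f]; have [b [hb hder]] := h (encode nameP nameR (l, f)).
exists b; split=> //; apply: (iff_trans hder); split=> [hacc|/entails_decided].
  exact/decided_entails/(der_sound hP hR hacc).
exact: der_complete.
Qed.
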